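(* Let $\gamma=0.06$, or, if only pairs $(n,m)$ with $n\ge 4m$ and $m\ge 10$ are considered, let $\gamma=0.18$. Fix real numbers $\sigma,\epsilon\ge 0$ with $\sigma+\epsilon\le 1$. Let $G=(V,E)$ be a graph with $n$ vertices and let $1<m\le n$ be an integer. (i) If there are no $m$-subsets $S\subset V$ with $\sigma(S)\ge\sigma$, then $$\mathrm{Density}_m(G)\ \le\ \binom nm\exp\left\{\gamma m\sigma+O\left(\frac1m\right)\right\}.$$ (ii) If the probability that a uniformly random $m$-subset $S\subset V$ satisfies $\sigma(S)\ge\sigma+\epsilon$ is at least $2\exp\{-\gamma\epsilon m\}$, then $$\mathrm{Density}_m(G)\ \ge\ 2\binom nm\exp\left\{\gamma m\sigma+O\left(\frac1m\right)\right\}.$$ Moreover, there is a deterministic algorithm which, given a graph $G$ with $n$ vertices and $m$ such that either the hypothesis of (i) or the hypothesis of (ii) holds, distinguishes between these two cases in $n^{O(\ln m)}$ time. All implicit constants in the ''$O$'' notation are absolute.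
   Context: Graphs are undirected, without loops or multiple edges. For a subset $S\subset V$ of the vertex set of $G=(V,E)$ with $|S|\ge 2$, the density of $S$ is $$\sigma(S)=\frac{|\{\{u,v\}\in E:\ u,v\in S\}|}{\binom{|S|}{2}}.$$ For the constant $\gamma>0$ in the claim, the density functional is $$\mathrm{Density}_m(G)=\sum_{\substack{S\subset V\\ |S|=m}} w(S),$$ where, for an $m$-subset $S$ with $\sigma(S)=t$, $$w(S)=e^{\gamma m}\left(1+\frac{\gamma}{m-1}\right)^{(t-1)\binom m2}\left(1-\frac{\gamma}{m-1}\right)^{(1-t)\binom m2}=\exp\left\{\gamma m\,\sigma(S)+O\left(\frac1m\right)\right\}.$$ Time is measured by the number of arithmetic operations. *)

(* Defs.v *)
From HB Require Import structures.
From mathcomp Require Import all_boot all_order all_algebra.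
From mathcomp Require Import all_reals all_analysis.

Set Implicit Arguments.
Unset Strict Implicit.
Unset Printing Implicit Defensive.

Import Order.TTheory GRing.Theory Num.Theory.
Local Open Scope ring_scope.

Record sgraph (V : finType) := SGraph {
  edges :> {set {set V}};
  edges_pairs : [forall e in edges, #|e| == 2]
}.

Section Density.
Variables (R : realType) (V : finType) (G : sgraph V).

(* Only used for sets with at least two vertices: otherwise the denominator
   is zero. *)
Definition density (S : {set V}) : R :=
  #|[set e in edges G | e \subset S]|%:R / 'C(#|S|, 2)%:R.

Definition weight (gamma : R) (m : nat) (S : {set V}) : R :=
  let t := density S in
  expR (gamma * m%:R)
  * (1 + gamma / (m%:R - 1)) `^ ((t - 1) * 'C(m, 2)%:R)
  * (1 - gamma / (m%:R - 1)) `^ ((1 - t) * 'C(m, 2)%:R).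

Definition Density (gamma : R) (m : nat) : R :=
  \sum_(S : {set V} | #|S| == m) weight gamma m S.

Definition no_dense_subset (m : nat) (sigma : R) : Prop :=
  forall S : {set V}, #|S| = m -> ~ (sigma <= density S).

Definition prob_dense (m : nat) (s : R) : R :=
  #|[set S : {set V} | (#|S| == m) && (s <= density S)]|%:R
  / #|[set S : {set V} | #|S| == m]|%:R.

Definition many_dense_subsets (gamma : R) (m : nat) (sigma eps : R) : Prop :=
  2 * expR (- (gamma * eps * m%:R)) <= prob_dense m (sigma + eps).

End Density.

Definition admissible (R : realType) (gamma : R) (n m : nat) : Prop :=
  gamma = 6 / 100 \/ [/\ gamma = 18 / 100, (4 * m <= n)%N & (10 <= m)%N].

(* A real random access machine.  A memory consists of an integer part W and a
   real part Q, both indexed by nat; addresses are themselves integer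
   expressions, which gives indirect addressing.  The program text is finite
   and contains no real constants.  Reals can be added, subtracted, multiplied,
   divided and compared exactly, but not rounded to integers.  Integers can
   only be added, subtracted (truncated at 0) and compared, so that products of
   large integers are not available for addressing at unit cost. *)

Inductive iexp : Type :=
| IConst of nat
| ILoad of iexp
| IAdd of iexp & iexp
| ISub of iexp & iexp.

Inductive rexp : Type :=
| RInt of iexp
| RLoad of iexp
| RAdd of rexp & rexp
| RSub of rexp & rexp
| RMul of rexp & rexp
| RDiv of rexp & rexp.

Inductive test : Type :=
| ILt of iexp & iexp
| RLt of rexp & rexp.

Inductive cmd : Type :=
| Skip
| IStore of iexp & iexp
| RStore of iexp & rexp
| Seq of cmd & cmd
| If of test & cmd & cmd
| While of test & cmd.

(* Every operation, load, constant, conversion and comparison costs 1. *)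
Fixpoint icost (e : iexp) : nat :=
  match e with
  | IConst _ => 1
  | ILoad a => (icost a).+1
  | IAdd a b | ISub a b => (icost a + icost b).+1
  end.

Fixpoint rcost (e : rexp) : nat :=
  match e with
  | RInt a | RLoad a => (icost a).+1
  | RAdd a b | RSub a b | RMul a b | RDiv a b => (rcost a + rcost b).+1
  end.

Definition tcost (b : test) : nat :=
  match b with
  | ILt x y => (icost x + icost y).+1
  | RLt x y => (rcost x + rcost y).+1
  end.

Section Machine.
Variable R : realType.

Record memory := Memory { imem : nat -> nat; rmem : nat -> R }.

Fixpoint ieval (s : memory) (e : iexp) : nat :=
  match e with
  | IConst c => c
  | ILoad a => imem s (ieval s a)
  | IAdd a b => (ieval s a + ieval s b)%N
  | ISub a b => (ieval s a - ieval s b)%N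
  end.

(* Division by zero returns 0. *)
Fixpoint reval (s : memory) (e : rexp) : R :=
  match e with
  | RInt a => (ieval s a)%:R
  | RLoad a => rmem s (ieval s a)
  | RAdd a b => reval s a + reval s b
  | RSub a b => reval s a - reval s b
  | RMul a b => reval s a * reval s b
  | RDiv a b => reval s a / reval s b
  end.

Definition teval (s : memory) (b : test) : bool :=
  match b with
  | ILt x y => (ieval s x < ieval s y)%N
  | RLt x y => reval s x < reval s y
  end.

Definition istore (s : memory) (a v : nat) : memory :=
  Memory [eta imem s with a |-> v] (rmem s).

Definition rstore (s : memory) (a : nat) (v : R) : memory :=
  Memory (imem s) [eta rmem s with a |-> v].

(* exec c s t s' : started in s, the program c halts in s' after t steps. *)
Inductive exec : cmd -> memory -> nat -> memory -> Prop :=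
| exec_skip s : exec Skip s 1 s
| exec_istore s a e :
    exec (IStore a e) s (icost a + icost e).+1
      (istore s (ieval s a) (ieval s e))
| exec_rstore s a e :
    exec (RStore a e) s (icost a + rcost e).+1
      (rstore s (ieval s a) (reval s e))
| exec_seq c1 c2 s1 t1 s2 t2 s3 :
    exec c1 s1 t1 s2 -> exec c2 s2 t2 s3 ->
    exec (Seq c1 c2) s1 (t1 + t2) s3
| exec_if b c1 c2 s t s' :
    exec (if teval s b then c1 else c2) s t s' ->
    exec (If b c1 c2) s (tcost b + t) s'
| exec_while_stop b c s :
    ~~ teval s b -> exec (While b c) s (tcost b) s
| exec_while_step b c s1 t1 s2 t2 s3 :
    teval s1 b -> exec c s1 t1 s2 -> exec (While b c) s2 t2 s3 ->
    exec (While b c) s1 (tcost b + t1 + t2) s3.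

Lemma exec_det c s t1 s1 t2 s2 :
  exec c s t1 s1 -> exec c s t2 s2 -> t1 = t2 /\ s1 = s2.
Proof.
move=> E1; elim: E1 t2 s2 => {c s t1 s1}.
- by move=> s t2 s2 E; inversion E; subst.
- by move=> s a e t2 s2 E; inversion E; subst.
- by move=> s a e t2 s2 E; inversion E; subst.
- move=> c1 c2 s1 t1 s2 t2 s3 _ IH1 _ IH2 t s E; inversion E; subst.
  match goal with H : exec c1 _ _ _ |- _ => have [? ?] := IH1 _ _ H end; subst.
  by match goal with H : exec c2 _ _ _ |- _ => have [-> ->] := IH2 _ _ H end.
- move=> b c1 c2 s t s' _ IH t2 s2 E; inversion E; subst.
  by match goal with H : exec (if _ then _ else _) _ _ _ |- _ =>
    have [-> ->] := IH _ _ H end.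
- move=> b c s nb t2 s2 E; inversion E; subst => //.
  by match goal with H : is_true (teval _ _) |- _ => rewrite H in nb end.
- move=> b c s1 t1 s2 t2 s3 tb _ IH1 _ IH2 t s E; inversion E; subst.
    by match goal with H : is_true (~~ _) |- _ => rewrite tb in H end.
  match goal with H : exec c _ _ _ |- _ => have [? ?] := IH1 _ _ H end; subst.
  by match goal with H : exec (While b c) _ _ _ |- _ =>
    have [-> ->] := IH2 _ _ H end.
Qed.

(* W[0] = n, W[1] = m, W[2 + n i + j] is the (i, j) entry of the adjacency
   matrix, Q[0] = sigma, Q[1] = eps; all other cells are 0. *)
Definition input (n m : nat) (G : sgraph 'I_n) (sigma eps : R) : memory :=
  Memory
    (fun a : nat =>
       if a == 0%N then n else if a == 1%N then m else
       [exists i : 'I_n, exists j : 'I_n,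
          (a == 2 + n * i + j)%N && ([set i; j] \in edges G)] : nat)
    (fun a : nat => if a == 0%N then sigma else if a == 1%N then eps else 0).

Definition output (s : memory) : nat := imem s 0.

End Machine.

(* Main.v *)
Require Import Defs.
From mathcomp Require Import all_boot all_order all_algebra.
From mathcomp Require Import zify ring lra.
From mathcomp Require Import all_reals all_analysis.

Set Implicit Arguments.
Unset Strict Implicit.
Unset Printing Implicit Defensive.

Import Order.TTheory GRing.Theory Num.Theory.
Import numFieldNormedType.Exports.
Local Open Scope ring_scope.

(** Let x = gamma / (m - 1) and N = 'C(m, 2).  The weight of an m-set of density
    t is exp (gamma m + (t - 1) N u) with u = ln ((1 + x) / (1 - x)), and
    2 x <= u <= 2 x + x ^ 3; as 2 x N = gamma m, it lies between
    exp (gamma m t - 1 / m) and exp (gamma m t) ([weight_bounds]).  Both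
    estimates of Density follow by summation, with K = 1.

    The two cases are told apart in polynomial time: the degree sequence is
    enough.  Write n for the number of vertices, e(S) for the number of edges
    inside S, g for the centred degrees divided by n, Gam for the sum of the
    g(v) ^ 2, and k = min (m, n - m).  The program compares sigma N with

      T = (m / n)^2 |E| + (3 / 4) (k / n) m Gam - m / 2.

    Some m-set spans at least T edges ([exists_dense]): the fractional set with
    coordinates m / n + (k / n) g(v) favours vertices of high degree, and rounding
    it to a set costs at most m / 2 edges.  So T <= sigma N if no m-set has
    density sigma.

    Conversely, put th = 2 gamma / (m - 1).  For a uniformly random m-set S, the
    expectation of exp (th e(S)) is at most exp (th T + 13 / 20)
    ([moment_bound]), and exp (13 / 20) < 2.  If many m-sets have density at
    least sigma + eps, then, since th N = gamma m, the same expectation is at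
    least 2 exp (- gamma eps m) exp (gamma m (sigma + eps))
    = 2 exp (th sigma N), and therefore sigma N < T.

    The moment bound is where gamma has to be small.  One has
    e(S) = (m / n)^2 |E| + m G(S) + Q(S), where G is the sum of g over S and Q is
    half the quadratic form, on the indicator of S, of the adjacency matrix
    centred along rows and columns.  Revealing S one vertex at a time, the new
    vertex changes the exponent by an almost centred quantity whose variance is a
    multiple of Gam plus a multiple of the energy R(S) of the field that the
    chosen vertices create.  The first multiple is what the term 3 / 4 ... of T
    pays for; the second is carried along as an extra summand s R(S) of the
    exponent, whose coefficient s solves a Riccati recursion that stays bounded
    up to m steps for the two admissible values of gamma ([moment_step],
    [moment_induction]). *)

(** * Elementary inequalities *)

Lemma le_of_derive_ge0 (R : realType) (f df : R -> R) (a b : R) :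
  a <= b -> (forall x, a <= x <= b -> is_derive x 1 f (df x)) ->
  (forall x, a < x < b -> 0 <= df x) -> f a <= f b.
Proof.
rewrite le_eqVlt => /predU1P[-> //|ab] fdf df0.
have [x||c] := @MVT R f df a b ab.
- by rewrite in_itv/= => /andP[ax xb]; apply: fdf; rewrite !ltW.
- apply: derivable_within_continuous => x; rewrite in_itv/= => xab.
  by have [] := fdf x xab.
- rewrite in_itv/= => /df0 dc0 /eqP.
  rewrite subr_eq => /eqP ->; rewrite lerDr mulr_ge0// subr_ge0 ltW//.
Qed.

(** The function (1 + u + 7/10 u^2) exp (- u) has derivative
    exp (- u) u (4/10 - 7/10 u), so on u <= 4/7 its minimum is at 0. *)
Lemma expR_le_quad (R : realType) (u : R) :
  u <= 4 / 7 -> expR u <= 1 + u + 7 / 10 * u ^+ 2.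
Proof.
move=> u47.
pose h (x : R) : R := (1 + x + 7 / 10 * x ^+ 2) * expR (- x).
pose dh (x : R) : R := expR (- x) * (x * (4 / 10 - 7 / 10 * x)).
have hdh (x : R) : is_derive x (1 : R) h (dh x).
  rewrite /h.
  apply: is_derive_eq.
  by rewrite /dh/= /GRing.scale/=; field.
have h0 : h 0 = 1 by rewrite /h expr0n/= mulr0 !addr0 oppr0 expR0 mulr1.
suff : 1 <= h u.
  by rewrite /h expRN ler_pdivlMr ?expR_gt0// mul1r.
have [u0|u0] := leP 0 u.
  rewrite -h0; apply: (@le_of_derive_ge0 _ h dh) => // y /andP[x0 xu].
  rewrite /dh mulr_ge0 ?expR_ge0// mulr_ge0 ?ltW//.
  lra.
rewrite -h0 -lerN2.
apply: (@le_of_derive_ge0 _ (fun x => - h x) (fun x => - dh x) u 0).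
- exact: ltW.
- move=> y /andP[ux x0]; rewrite /dh oppr_ge0 mulr_ge0_le0 ?expR_ge0//.
  by rewrite mulr_le0_ge0 ?ltW//; lra.
Qed.

(** The constant 13/20 is the total error allowed in the exponent of the moment
    bound; the factor 2 in the hypothesis of the dense case absorbs it. *)
Lemma expR_13_20_lt2 (R : realType) : expR (13 / 20 : R) < 2.
Proof.
have -> : (13 / 20 : R) = 10%:R * (13 / 200) by field.
rewrite expRM_natl.
have e1 : expR (13 / 200 : R) <= 200 / 187.
  have := expR_ge1Dx (- (13 / 200) : R).
  rewrite expRN => h.
  rewrite -[leLHS]invrK -[leRHS]invrK lef_pV2 ?posrE ?invr_gt0 ?expR_gt0//.
  by apply: le_trans h; lra.
apply: le_lt_trans (_ : (200 / 187 : R) ^+ 10 < 2).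
  by rewrite lerXn2r ?nnegrE ?expR_ge0//; lra.
lra.
Qed.

(** The derivative of the middle term is 2 / (1 - x^2), which lies between 2 and
    2 + 3 x^2. *)
Lemma ln_ratio_bounds (R : realType) (x : R) : 0 <= x <= 1 / 2 ->
  2 * x <= ln (1 + x) - ln (1 - x) <= 2 * x + x ^+ 3.
Proof.
move=> /andP[x0 x1].
have D (y : R) : -1 < y < 1 -> is_derive y (1 : R) (fun y : R => ln (1 + y) - ln (1 - y))
    (2 / (1 - y ^+ 2)).
  move=> y1.
  have d1 : is_derive y (1 : R) (fun y : R => ln (1 + y)) (1 + y)^-1.
    have d0 : is_derive y (1 : R) (fun y : R => 1 + y) 1.
      by apply: is_derive_eq; rewrite add0r mulr1.
    have := @is_derive1_comp _ (@ln R) (fun y : R => 1 + y) y _ _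
      (@is_derive1_ln _ (1 + y) ltac:(lra)) d0.
    by rewrite mulr1.
  have d2 : is_derive y (1 : R) (fun y : R => ln (1 - y)) (- (1 - y)^-1).
    have d0 : is_derive y (1 : R) (fun y : R => 1 - y) (-1).
      by apply: is_derive_eq; rewrite /GRing.scale/=; ring.
    have := @is_derive1_comp _ (@ln R) (fun y : R => 1 - y) y _ _
      (@is_derive1_ln _ (1 - y) ltac:(lra)) d0.
    by rewrite mulrN1.
  apply: is_derive_eq; field.
  apply/andP; split; nra.
apply/andP; split.
  pose f (y : R) : R := (ln (1 + y) - ln (1 - y)) - 2 * y.
  suff : f 0 <= f x by rewrite /f addr0 subr0 mulr0 subrr subr0 subr_ge0.
  apply: (@le_of_derive_ge0 _ f (fun y => 2 / (1 - y ^+ 2) - 2)) => // y.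
    move=> y1; have dy := D y ltac:(lra).
    rewrite /f; apply: is_derive_eq; rewrite /GRing.scale/=; ring.
  move=> /andP[y0 y1]; rewrite subr_ge0 ler_pdivlMr; nra.
pose f (y : R) : R := 2 * y + y ^+ 3 - (ln (1 + y) - ln (1 - y)).
suff : f 0 <= f x by rewrite /f addr0 subr0 mulr0 subrr expr0n/= addr0 subr0 subr_ge0.
apply: (@le_of_derive_ge0 _ f (fun y => 2 + 3 * y ^+ 2 - 2 / (1 - y ^+ 2))) => // y.
  move=> y1; have dy := D y ltac:(lra).
  rewrite /f; apply: is_derive_eq; rewrite /GRing.scale/=; ring.
move=> /andP[y0 y1].
have z1 : y ^+ 2 <= 1 / 4 by nra.
have := sqr_ge0 y; move: (y ^+ 2) z1 => z z1 z0.
by rewrite subr_ge0 ler_pdivrMr; nra.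
Qed.

(** * Rounding a fractional set *)

Section Rounding.
Variables (R : realType) (V : finType).

Definition qform (C : V -> V -> R) (y : V -> R) : R :=
  \sum_u \sum_v C u v * (y u * y v).

Lemma sum_pick_diff (i j : V) (f : V -> R) :
  \sum_v ((v == i)%:R - (v == j)%:R) * f v = f i - f j.
Proof.
under eq_bigr do rewrite mulrBl.
rewrite sumrB; congr (_ - _).
  by rewrite (bigD1 i)//= eqxx mul1r big1 ?addr0// => v /negbTE ->; rewrite mul0r.
by rewrite (bigD1 j)//= eqxx mul1r big1 ?addr0// => v /negbTE ->; rewrite mul0r.
Qed.

Variable C : V -> V -> R.
Hypothesis C_sym : forall u v, C u v = C v u.

Lemma qformD (y z : V -> R) :
  qform C (fun v => y v + z v) =
  qform C y + 2 * (\sum_u z u * \sum_v C u v * y v) + qform C z.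
Proof.
have E : \sum_u \sum_v C u v * (y u * z v) = \sum_u \sum_v C u v * (z u * y v).
  rewrite exchange_big; apply: eq_bigr => u _; apply: eq_bigr => v _.
  by rewrite C_sym (mulrC (y v)).
transitivity (qform C y + (\sum_u \sum_v C u v * (y u * z v)
   + \sum_u \sum_v C u v * (z u * y v)) + qform C z).
  rewrite -!big_split/=; apply: eq_bigr => u _.
  rewrite -!big_split/=; apply: eq_bigr => v _; ring.
rewrite E; congr (_ + _ + _); rewrite mulr2n mulrDl mul1r.
have -> // : \sum_u \sum_v C u v * (z u * y v) = \sum_u z u * \sum_v C u v * y v.
by apply: eq_bigr => u _; rewrite mulr_sumr; apply: eq_bigr => v _; ring.
Qed.

Hypothesis C_diag : forall v, C v v = 1.
Hypothesis C_le1 : forall u v, C u v <= 1.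

(** Moving mass t from j to i adds t^2 (2 - 2 C i j) >= 0 to the linear term: the
    form is convex along exchange directions. *)
Lemma qform_exchange (y : V -> R) (i j : V) (t : R) :
  qform C y + 2 * t * (\sum_v C i v * y v - \sum_v C j v * y v)
  <= qform C (fun v => y v + t * ((v == i)%:R - (v == j)%:R)).
Proof.
rewrite qformD.
have -> : \sum_u t * ((u == i)%:R - (u == j)%:R) * (\sum_v C u v * y v) =
    t * (\sum_v C i v * y v - \sum_v C j v * y v).
  rewrite -(sum_pick_diff i j (fun u => \sum_v C u v * y v)) mulr_sumr.
  by apply: eq_bigr => u _; rewrite mulrA.
rewrite mulrA lerDl /qform.
have -> : \sum_u \sum_v C u v * (t * ((u == i)%:R - (u == j)%:R)
     * (t * ((v == i)%:R - (v == j)%:R))) =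
  t ^+ 2 * (2 - 2 * C i j).
  under eq_bigr => u _.
    under eq_bigr => v _.
      rewrite (_ : _ * _ = ((v == i)%:R - (v == j)%:R)
        * (t ^+ 2 * ((u == i)%:R - (u == j)%:R) * C u v)); last by ring.
      over.
    rewrite (sum_pick_diff i j (fun v => t ^+ 2 * ((u == i)%:R - (u == j)%:R) * C u v)).
    rewrite (_ : _ - _ = ((u == i)%:R - (u == j)%:R)
      * (t ^+ 2 * (C u i - C u j))); last by ring.
    over.
  rewrite (sum_pick_diff i j (fun u => t ^+ 2 * (C u i - C u j))).
  by rewrite !C_diag (C_sym j i); ring.
by rewrite mulr_ge0 ?sqr_ge0// subr_ge0; have := C_le1 i j; lra.
Qed.

(** Pipage rounding.  By convexity an exchange between two fractional coordinates,
    in the direction in which the form increases, can be continued until one of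
    them becomes integral.  Since the coordinates have an integral sum, a single
    fractional coordinate is impossible. *)
Lemma round_fractional (m : nat) (y : V -> R) :
  (forall v, 0 <= y v <= 1) -> \sum_v y v = m%:R ->
  exists S : {set V}, #|S| = m /\ qform C y <= qform C (fun v => (v \in S)%:R).
Proof.
have [N] := ubnP #|[set v | 0 < y v < 1]|; elim: N y => // N IH y cardN y01 ysum.
pose S1 := [set v | y v == 1].
have nonfrac v : ~~ (0 < y v < 1) -> y v = (v \in S1)%:R.
  rewrite inE; have /andP[] := y01 v; rewrite !le_eqVlt.
  by move=> /predU1P[<- _|-> /predU1P[->|->]//]; rewrite ?eqxx// eq_sym oner_eq0.
have [i ifrac|nofrac] := pickP (fun i => 0 < y i < 1); last first.
  have yE v : y v = (v \in S1)%:R.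
    by apply: nonfrac; rewrite nofrac.
  exists S1; split; last by rewrite /qform; under eq_bigr do under eq_bigr do rewrite !yE.
  apply/eqP; rewrite -(eqr_nat R) -ysum -sum1_card natr_sum big_mkcond/=.
  by apply/eqP/eq_bigr => v _; rewrite yE; case: (v \in S1).
have [j /andP[ji jfrac]|only] :=
  pickP (fun j => (j != i) && (0 < y j < 1)); last first.
  exfalso.
  have : m%:R = y i + #|S1 :\ i|%:R.
    rewrite -ysum (bigD1 i)//=; congr (_ + _).
    rewrite -sum1_card natr_sum big_mkcond [RHS]big_mkcond/=.
    apply: eq_bigr => v _; rewrite in_setD1; case: (eqVneq v i) => //= vi.
    rewrite nonfrac; first by case: (v \in S1).
    by have := only v; rewrite vi /= => ->.
  move: ifrac => /andP[i0 i1] mE.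
  have : (#|S1 :\ i| < m)%N by rewrite -(ltr_nat R) mE ltrDr.
  by rewrite ltnNge -ltnS -(ltr_nat R) mE -addn1 natrD addrC ltrD2l i1.
(* the direction of the exchange is chosen so that the linear term is nonnegative *)
wlog lin : i j ji ifrac jfrac / \sum_v C j v * y v <= \sum_v C i v * y v.
  move=> W; have [|/ltW] := leP (\sum_v C j v * y v) (\sum_v C i v * y v).
    exact: W.
  by apply: W => //; rewrite eq_sym.
pose t := Num.min (1 - y i) (y j).
pose y' v := y v + t * ((v == i)%:R - (v == j)%:R).
have t0 : 0 < t by rewrite lt_min subr_gt0; lra.
have y'i : y' i = y i + t by rewrite /y' eqxx eq_sym (negbTE ji) subr0 mulr1.
have y'j : y' j = y j - t by rewrite /y' eqxx (negbTE ji) sub0r mulrN1.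
have y'v v : v != i -> v != j -> y' v = y v.
  by rewrite /y' => /negbTE -> /negbTE ->; rewrite subrr mulr0 addr0.
have ti : t <= 1 - y i by rewrite ge_min lexx.
have tj : t <= y j by rewrite ge_min lexx orbT.
have [||| S [cS FS]] := IH y'.
- rewrite -ltnS (leq_trans _ cardN)// ltnS; apply: proper_card.
  have sub : [set v | 0 < y' v < 1] \subset [set v | 0 < y v < 1].
    apply/subsetP => v; rewrite !inE.
    have [->//|vi] := eqVneq v i; have [->//|vj] := eqVneq v j.
    by rewrite y'v.
  apply/properP; split=> //.
  have [tE|tE] := leP (1 - y i) (y j).
    exists i; rewrite !inE// y'i.
    by apply/negP => /andP[_]; rewrite /t min_l// addrC subrK ltxx.
  exists j; rewrite !inE// y'j.
  by apply/negP => /andP[]; rewrite /t min_r ?subrr ?ltxx// ltW.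
- move=> v; have [->|vi] := eqVneq v i; first by rewrite y'i; lra.
  have [->|vj] := eqVneq v j; first by rewrite y'j; lra.
  by rewrite y'v.
- rewrite big_split/= ysum -mulr_sumr.
  under [X in _ * X]eq_bigr do rewrite -[X in X - _]mulr1 -[X in _ - X]mulr1 -mulrBl.
  by rewrite (sum_pick_diff i j (fun=> 1)) subrr mulr0 addr0.
exists S; split=> //; apply: le_trans FS; apply: le_trans (qform_exchange y i j t).
by rewrite lerDl mulr_ge0 ?subr_ge0// mulr_ge0// ltW.
Qed.

End Rounding.

(** * Exponential moments over random subsets *)

(** Both sides enumerate the pairs of a (c + 1)-set and one of its elements. *)
Lemma sum_subsets_succ (R : realType) (V : finType) (c : nat) (F : {set V} -> R) :
  c.+1%:R * (\sum_(S : {set V} | #|S| == c.+1) F S) =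
  \sum_(S : {set V} | #|S| == c) \sum_(v | v \notin S) F (v |: S).
Proof.
transitivity (\sum_(S : {set V} | #|S| == c.+1) \sum_(v in S) F S).
  by rewrite mulr_sumr; apply: eq_bigr => S /eqP cS; rewrite sumr_const cS mulr_natl.
rewrite (exchange_big_dep xpredT)//= [RHS](exchange_big_dep xpredT)//=.
apply: eq_bigr => v _.
rewrite (reindex_onto (fun S => v |: S) (fun S => S :\ v)) /=; last first.
  by move=> S /andP[_ vS]; rewrite setD1K.
apply: eq_bigl => S; rewrite setU11 andbT cardsU1.
have [vS|vS] := boolP (v \in S).
  rewrite andbF; apply/andP => -[_ /eqP]; move=> E.
  by have := setD11 v (v |: S); rewrite E vS.
by rewrite setU1K// eqxx !andbT add1n eqSS.
Qed.

(** The kernel B and the linear weights g are the doubly centred adjacency matrix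
    and the centred degrees divided by n.  As B + g is an adjacency entry minus a
    number in [0, 1], it is bounded by 1, and B has operator norm at most n / 2 on
    vectors of sum 0. *)
Section ExponentialMoment.
Variables (R : realType) (V : finType) (B : V -> V -> R) (g : V -> R).
Let n : R := #|V|%:R.
Let Gam : R := \sum_v g v ^+ 2.

Hypothesis n_gt0 : 0 < n.
Hypothesis B_sym : forall v w, B v w = B w v.
Hypothesis B_row0 : forall v, \sum_w B v w = 0.
Hypothesis g_sum0 : \sum_v g v = 0.
Hypothesis g_le1 : forall v, `|g v| <= 1.
Hypothesis Bg_le1 : forall v w, `|B v w + g w| <= 1.
Hypothesis B_diag : forall v, B v v <= - 2 * g v.
Hypothesis B_op : forall z : V -> R, \sum_v z v = 0 ->
  \sum_v (\sum_w B v w * z w) ^+ 2 <= (n / 2) ^+ 2 * \sum_v z v ^+ 2.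

Definition linpart (S : {set V}) : R := \sum_(v in S) g v.
Definition field (S : {set V}) (w : V) : R := \sum_(v in S) B v w.
Definition quadpart (S : {set V}) : R := (\sum_(w in S) field S w) / 2.
Definition energy (S : {set V}) : R := (\sum_w field S w ^+ 2) / n.
Definition potential (l t s : R) (S : {set V}) : R :=
  l * linpart S + t * quadpart S + s * energy S.

Implicit Types (S : {set V}) (v w : V).

Let Bfield S v := \sum_w B v w * field S w.

(** Row v of B is orthogonal to constants, so subtracting a constant from the
    vector B v + g v, whose entries are bounded by 1, only shortens it. *)
Lemma B_norm v : \sum_w B v w ^+ 2 <= n.
Proof.
have : \sum_w (B v w + g v) ^+ 2 <= n.
  rewrite /n -sum1_card natr_sum; apply: ler_sum => w _.
  by rewrite -real_normK ?num_real// expr_le1// B_sym.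
under eq_bigr do rewrite sqrrD.
rewrite !big_split/= -mulr_suml B_row0 mul0r !addr0 => h.
by apply: le_trans h; rewrite lerDl sumr_ge0// => w _; exact: sqr_ge0.
Qed.

Lemma energy_ge0 S : 0 <= energy S.
Proof.
by apply: divr_ge0; [apply: sumr_ge0 => v _; exact: sqr_ge0|exact: ltW].
Qed.

Lemma field_sum0 S : \sum_w field S w = 0.
Proof. by rewrite exchange_big big1. Qed.

Lemma Bfield_sum S : \sum_(v in S) Bfield S v = n * energy S.
Proof.
rewrite /energy mulrCA divff ?mulr1 ?gt_eqF//.
rewrite exchange_big; apply: eq_bigr => w _.
by rewrite -mulr_suml expr2.
Qed.

Lemma Bfield_sum0 S : \sum_v Bfield S v = 0.
Proof.
rewrite exchange_big big1// => w _.
by rewrite -mulr_suml (eq_bigr (fun v => B w v)) ?B_row0 ?mul0r.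
Qed.

Lemma Bfield_le S v : Bfield S v <= n * #|S|%:R.
Proof.
have -> : Bfield S v = \sum_(u in S) \sum_w B v w * B u w.
  by rewrite exchange_big; apply: eq_bigr => w _; rewrite -mulr_sumr.
rewrite mulr_natr -sumr_const; apply: ler_sum => u _.
apply: (@le_trans _ _ (\sum_w (B v w ^+ 2 + B u w ^+ 2) / 2)).
  by apply: ler_sum => w _; have := sqr_ge0 (B v w - B u w); rewrite sqrrB; lra.
rewrite -mulr_suml big_split/= ler_pdivrMr//.
by have := B_norm v; have := B_norm u; lra.
Qed.

(** Splitting off t #|S| g keeps the bound at the size of the natural range of
    the increment; estimating the two summands separately would be too coarse for
    gamma = 18/100. *)
Lemma field_le S v (l t : R) : 0 <= t ->
  l * g v + t * field S v <= `|l - t * #|S|%:R| + t * #|S|%:R.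
Proof.
move=> t0.
have -> : l * g v + t * field S v =
    (l - t * #|S|%:R) * g v + t * (\sum_(u in S) (B u v + g v)).
  rewrite big_split/= sumr_const -mulr_natr /field; ring.
apply: lerD.
  apply: le_trans (ler_norm _) _; rewrite normrM ler_piMr//.
apply: ler_wpM2l => //; rewrite -sumr_const.
by apply: ler_sum => u _; apply: le_trans (Bg_le1 u v); exact: ler_norm.
Qed.

(** The part of the increment of the potential that has sum 0 over all vertices. *)
Let incr (l t s : R) S v : R :=
  l * g v + t * field S v + 2 * s / n * Bfield S v.

(** The diagonal term t B v v / 2 lowers the linear coefficient from l to l - t,
    and the last summand s bounds s times the squared norm of row v. *)
Lemma potentialU1 (l t s : R) S v : 0 <= t -> 0 <= s -> v \notin S ->
  potential l t s (v |: S) <= potential l t s S + incr (l - t) t s S v + s.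
Proof.
move=> t0 s0 vS.
have lE : linpart (v |: S) = g v + linpart S by rewrite /linpart big_setU1.
have fE w : field (v |: S) w = B v w + field S w by rewrite /field big_setU1.
have qE : quadpart (v |: S) = quadpart S + field S v + B v v / 2.
  rewrite /quadpart big_setU1//=; under eq_bigr do rewrite fE.
  rewrite fE big_split/= (eq_bigr (fun w => B w v)); last by move=> w _; exact: B_sym.
  by rewrite -/(field S v); field.
have eE : energy (v |: S) <= energy S + 2 / n * Bfield S v + 1.
  rewrite /energy; under eq_bigr do rewrite fE sqrrD.
  rewrite !big_split/= -/(Bfield S v) !mulrDl.
  have : (\sum_i B v i ^+ 2) / n <= 1 by rewrite ler_pdivrMr// mul1r B_norm.
  have -> : 1 / n * Bfield S v = Bfield S v / n by ring.
  lra.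
have := ler_wpM2l s0 eE; have := ler_wpM2l t0 (B_diag v).
rewrite /potential /incr lE qE.
have -> : 2 * s / n * Bfield S v = s * (2 / n * Bfield S v) by ring.
move: (2 / n * Bfield S v) (energy _) (energy S) => b e1 e0.
lra.
Qed.

(** A vertex outside S is not uniform on V.  Since the increments have sum 0 over
    V, their mean outside S only damps the coefficients l, t and s. *)
Lemma incr_sum (l t s : R) S :
  \sum_(v | v \notin S) incr l t s S v =
  - (l * linpart S + 2 * t * quadpart S + 2 * s * energy S).
Proof.
have E : \sum_v incr l t s S v = 0.
  by rewrite !big_split/= -!mulr_sumr g_sum0 field_sum0 Bfield_sum0 !mulr0 !addr0.
have : \sum_(v in S) incr l t s S v =
    l * linpart S + 2 * t * quadpart S + 2 * s * energy S.
  rewrite !big_split/= -!mulr_sumr Bfield_sum /quadpart /linpart.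
  field; exact: lt0r_neq0.
move=> <-; apply/eqP; rewrite -addr_eq0 addrC.
by rewrite -(bigID (mem S) xpredT (incr l t s S))/= E.
Qed.

(** Weighted Cauchy inequality (a + b)^2 <= 11/5 a^2 + 11/6 b^2, where the
    operator norm of B bounds the second part by a multiple of the energy. *)
Lemma incr_sqr_sum (l t s : R) S : 0 <= t -> 0 <= s ->
  \sum_v incr l t s S v ^+ 2 <=
  11 / 5 * l ^+ 2 * Gam + 11 / 6 * (t + s) ^+ 2 * (n * energy S).
Proof.
move=> t0 s0.
have nE : n * energy S = \sum_v field S v ^+ 2.
  by rewrite /energy mulrCA divff ?mulr1 ?gt_eqF.
pose z v := t * field S v + 2 * s / n * Bfield S v.
have zE : \sum_v z v ^+ 2 <= (t + s) ^+ 2 * (n * energy S).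
  have h : \sum_v z v ^+ 2 <= \sum_v ((t ^+ 2 + t * s) * field S v ^+ 2
      + (s ^+ 2 + t * s) * (2 / n) ^+ 2 * Bfield S v ^+ 2).
    apply: ler_sum => v _; rewrite /z.
    have -> : 2 * s / n * Bfield S v = s * (2 / n * Bfield S v) by ring.
    rewrite -(mulrA (_ + _)) -exprMn.
    move: (2 / n * Bfield S v) (field S v) => b f.
    have : 0 <= t * s * (f - b) ^+ 2 by rewrite mulr_ge0 ?sqr_ge0// mulr_ge0.
    nra.
  apply: le_trans h _; rewrite big_split/= -!mulr_sumr -nE.
  have hB : (2 / n) ^+ 2 * \sum_v Bfield S v ^+ 2 <= n * energy S.
    have := B_op (field_sum0 S); rewrite -nE -ler_pdivrMl ?exprn_gt0 ?divr_gt0//.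
    by rewrite -exprVn invf_div.
  have ts : 0 <= s ^+ 2 + t * s by rewrite addr_ge0 ?sqr_ge0// mulr_ge0.
  have := ler_wpM2l ts hB; rewrite mulrA; move: (\sum_v _) => b; nra.
apply: (@le_trans _ _ (\sum_v (11 / 5 * l ^+ 2 * g v ^+ 2 + 11 / 6 * z v ^+ 2))).
  apply: ler_sum => v _; rewrite /incr -addrA -/(z v).
  have := sqr_ge0 (6 * (l * g v) - 5 * z v); move: (g v) (z v) => a b; nra.
rewrite big_split/= -!mulr_sumr -/Gam lerD2l -(mulrA (11 / 6)).
exact: ler_wpM2l.
Qed.

(** One vertex is averaged out.  By [expR_le_quad] only the mean and the variance
    of the increment matter: the mean changes l and t, and the variance goes into
    the coefficient of the energy and into a constant.  Here 77/60 = 7/10 * 11/6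
    and 77/50 = 7/10 * 11/5. *)
Lemma moment_step (l t s : R) S (N : R) : 0 <= t -> 0 <= s ->
  N = n - #|S|%:R -> 0 < N ->
  `|(l - t) - t * #|S|%:R| + t * #|S|%:R + 2 * s * #|S|%:R <= 4 / 7 ->
  \sum_(v | v \notin S) expR (potential l t s (v |: S)) <=
  N * expR (potential (l - (l - t) / N) (t - 2 * t / N)
              (s + 77 / 60 * (n / N) * (t + s) ^+ 2) S
            + (s + 77 / 50 * (l - t) ^+ 2 * Gam / N)).
Proof.
move=> t0 s0 NE N0 small.
set p := l - t.
have incr_le v : incr p t s S v <= 4 / 7.
  apply: le_trans small; apply: lerD; first exact: field_le.
  have := Bfield_le S v; rewrite -ler_pdivrMl// => /(ler_wpM2l (_ : 0 <= 2 * s)).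
  by rewrite mulrA; apply; rewrite mulr_ge0.
apply: (@le_trans _ _ (\sum_(v | v \notin S) expR (potential l t s S + s) *
    (1 + incr p t s S v + 7 / 10 * incr p t s S v ^+ 2))).
  apply: ler_sum => v vS.
  apply: (@le_trans _ _ (expR (potential l t s S + s) * expR (incr p t s S v))).
    by rewrite -expRD ler_expR addrAC potentialU1.
  by rewrite ler_wpM2l ?expR_ge0// expR_le_quad.
rewrite -mulr_sumr big_split/= big_split/= incr_sum -mulr_sumr.
have -> : \sum_(v | v \notin S) (1 : R) = N.
  rewrite sumr_const NE /n -(cardsC S) natrD addrAC subrr add0r.
  by congr (_ *+ _); apply: eq_card => v; rewrite !inE.
have sq : \sum_(v | v \notin S) incr p t s S v ^+ 2 <= \sum_v incr p t s S v ^+ 2.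
  rewrite [leRHS](bigID (fun v => v \notin S))/= lerDl sumr_ge0// => v _.
  exact: sqr_ge0.
pose X := (- (p * linpart S + 2 * t * quadpart S) + 77 / 50 * p ^+ 2 * Gam
   + 77 / 60 * (t + s) ^+ 2 * (n * energy S)) / N.
apply: (@le_trans _ _ (expR (potential l t s S + s) * (N * (1 + X)))).
  rewrite ler_wpM2l ?expR_ge0// mulrDr mulr1 [N * X]mulrC divfK ?gt_eqF//.
  have := le_trans sq (incr_sqr_sum p S t0 s0).
  have := mulr_ge0 s0 (energy_ge0 S); lra.
rewrite mulrCA; apply: ler_wpM2l; first exact: ltW.
apply: (@le_trans _ _ (expR (potential l t s S + s) * expR X)).
  by rewrite ler_wpM2l ?expR_ge0// expR_ge1Dx.
rewrite -expRD ler_expR le_eqVlt; apply/orP; left; apply/eqP.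
rewrite /potential /X -/p; field; exact: lt0r_neq0.
Qed.

Section Induction.
Variables (th kap Lam q : R) (k : nat).
(* k is the number of vertices to average out, kap bounds n / (n - j) for j < k,
   Lam bounds the linear coefficient, and q bounds s i * c when i + c + 1 = k. *)
Let al : R := 77 / 60 * kap.
Let D : R := al * th ^+ 2 / (2 * (1 - al * th * k%:R)).
(* The coefficient of the energy after i steps: the solution of the continuous
   Riccati equation s' = al (th + s)^2 with s 0 = 0, sampled at integers. *)
Let s (i : nat) : R := th / (1 - al * th * i%:R) - th.

Hypothesis th_ge0 : 0 <= th.
Hypothesis kap_gt0 : 0 < kap.
Hypothesis k_lt_n : k%:R + 1 <= n.
Hypothesis n_le_kap : n <= kap * (n - k%:R + 1).
Hypothesis al_lt1 : al * th * k%:R < 1.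
Hypothesis q_large : al * (th * (k%:R - 1) + q) ^+ 2 <= 4 * q.
Hypothesis Lam_large : 2 * th <= Lam.

Let al_gt0 : 0 < al. Proof. by rewrite mulr_gt0. Qed.

Let den_gt0 i : (i <= k)%N -> 0 < 1 - al * th * i%:R.
Proof.
move=> ik; rewrite subr_gt0; apply: le_lt_trans al_lt1.
by apply: ler_wpM2l; [rewrite mulr_ge0// ltW|rewrite ler_nat].
Qed.

Let sE i : (i <= k)%N -> s i = al * th ^+ 2 * i%:R / (1 - al * th * i%:R).
Proof. by move=> ik; rewrite /s; have := den_gt0 ik => h; field; lra. Qed.

Let s_ge0 i : (i <= k)%N -> 0 <= s i.
Proof.
move=> ik; rewrite sE// divr_ge0//; last exact/ltW/den_gt0.
by rewrite !mulr_ge0 ?sqr_ge0// ltW.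
Qed.

Let s_riccati i : (i < k)%N -> s i + al * (th + s i) ^+ 2 <= s i.+1.
Proof.
move=> ik; have P1 := den_gt0 (ltnW ik); have P2 := den_gt0 ik.
rewrite /s [th + _]addrC subrK addrAC lerD2r.
rewrite -natr1 mulrDr mulr1 opprD addrA in P2 *.
set P := 1 - al * th * i%:R in P1 P2 *; set a := al * th in P2 *.
have -> : th / P + al * (th / P) ^+ 2 = th * ((P + a) / P ^+ 2).
  by rewrite /a; field; lra.
apply: ler_wpM2l => //; rewrite ler_pdivrMr ?exprn_gt0// mulrC ler_pdivlMr//.
by have := sqr_ge0 a; nra.
Qed.

(* With x = th i and y = th c, a sum x + y fixed by k, the bound
   al x y <= q (1 - al x) is a quadratic inequality in x, and q_large says that
   its discriminant is not positive. *)
Let s_size i c : (i + c.+1 = k)%N -> s i * c%:R <= q.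
Proof.
move=> ik; have ik' : (i <= k)%N by rewrite -ik leq_addr.
have P1 := den_gt0 ik'; rewrite sE// mulrAC ler_pdivrMr//.
have E : th * (k%:R - 1) = th * i%:R + th * c%:R by rewrite -ik natrD -natr1; ring.
have := q_large; rewrite E.
have -> : al * th ^+ 2 * i%:R * c%:R = al * (th * i%:R) * (th * c%:R) by ring.
have -> : al * th * i%:R = al * (th * i%:R) by ring.
move: (th * i%:R) (th * c%:R) => x y h.
rewrite -subr_ge0 -(pmulr_rge0 _ (_ : 0 < 4 * al)); last by rewrite mulr_gt0.
have -> : 4 * al * (q * (1 - al * x) - al * x * y) =
   (al * (2 * x - (x + y + q))) ^+ 2 + al * (4 * q - al * (x + y + q) ^+ 2) by ring.
by rewrite addr_ge0 ?sqr_ge0// mulr_ge0 ?subr_ge0// ltW.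
Qed.

(* The right-hand side telescopes to D k^2 over all steps. *)
Let s_le i : (i <= k)%N -> s i <= D * (i.+1%:R ^+ 2 - i%:R ^+ 2).
Proof.
move=> ik; have P1 := den_gt0 ik; have P2 := den_gt0 (leqnn k).
rewrite sE//.
have A0 : 0 <= al * th ^+ 2 by rewrite mulr_ge0 ?sqr_ge0// ltW.
apply: (@le_trans _ _ (al * th ^+ 2 * i%:R / (1 - al * th * k%:R))).
  apply: ler_wpM2l; first by rewrite mulr_ge0.
  rewrite lef_pV2 ?posrE// lerB// ler_wpM2l ?ler_nat//.
  by rewrite mulr_ge0// ltW.
have -> : D * (i.+1%:R ^+ 2 - i%:R ^+ 2) =
   al * th ^+ 2 * (i%:R + 1 / 2) / (1 - al * th * k%:R).
  rewrite /D -natr1; field; lra.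
apply: ler_wpM2r; first by rewrite invr_ge0 ltW.
by apply: ler_wpM2l => //; rewrite lerDl.
Qed.

(** The increments must stay below 4/7 at every step.  By [field_le] this holds if
    the linear and the quadratic coefficients are small enough to be added; or, with
    larger constants, if l - t >= t (j - 1), for then (l - t) g + t field is at most
    l - t, and the recursion preserves this inequality. *)
Lemma moment_induction (j : nat) (l t : R) : (j <= k)%N ->
  0 <= t <= th -> `|l - t| <= Lam ->
  Lam + 2 * th * (k%:R - 1) + 2 * q <= 4 / 7 \/
    t * (j%:R - 1) <= l - t /\ Lam + 2 * q <= 4 / 7 ->
  \sum_(S : {set V} | #|S| == j) expR (potential l t (s (k - j)) S) <=
  'C(#|V|, j)%:R * expR (j%:R * (77 / 50 * kap * Lam ^+ 2 * Gam / n)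
                         + D * (k%:R ^+ 2 - (k - j)%:R ^+ 2)).
Proof.
elim: j l t => [|c IH] l t jk /andP[t0 tth] lL small.
  rewrite (big_pred1 set0) => [|S]; last by rewrite cards_eq0.
  rewrite /potential /linpart /quadpart /energy /field !big_set0.
  rewrite (big1 _ xpredT) => [|w _]; last by rewrite big_set0 expr0n.
  by rewrite !mul0r !mulr0 subn0 subrr mulr0 !addr0 expR0 bin0 mul1r.
set i := (k - c.+1)%N.
have ik : (i + c.+1 = k)%N by rewrite subnK.
have i1k : (k - c = i.+1)%N by rewrite -ik addnS subSn ?leq_addl// addnK.
have ilt : (i < k)%N by rewrite -i1k leq_subr.
pose N : R := n - c%:R.
have ckR : c%:R <= k%:R - 1 :> R by rewrite lerBrDr natr1 ler_nat.
have N2 : 2 <= N by rewrite /N; move: k_lt_n ckR; lra.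
have N0 : 0 < N by lra.
have kapN : n <= kap * N.
  by apply: le_trans n_le_kap _; apply: ler_wpM2l; [exact: ltW|rewrite /N; lra].
have nNk : n / N <= kap by rewrite ler_pdivrMr.
have NV : N^-1 <= kap / n by rewrite -[leLHS]mul1r ler_pdivrMr// mulrAC ler_pdivlMr// mul1r.
have y0 : 0 < N^-1 by rewrite invr_gt0.
have y2 : N^-1 <= 1 / 2 by rewrite -[leLHS]mul1r ler_pdivrMr//; lra.
have c0 : 0 <= c%:R :> R by [].
have sc := s_size ik.
have smallc : `|(l - t) - t * c%:R| + t * c%:R + 2 * s i * c%:R <= 4 / 7.
  rewrite -(mulrA 2); case: small => [small|[lt small]].
    have h1 := ler_normB (l - t) (t * c%:R).
    rewrite (ger0_norm (_ : 0 <= t * c%:R)) ?mulr_ge0// in h1.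
    have h2 : t * c%:R <= th * (k%:R - 1) by exact: ler_pM.
    rewrite -mulrA in small; lra.
  rewrite -natr1 addrK in lt.
  rewrite ger0_norm ?subr_ge0// subrK.
  have := ler_norm (l - t); lra.
set A := 77 / 50 * kap * Lam ^+ 2 * Gam / n.
have Gam0 : 0 <= Gam by apply: sumr_ge0 => v _; exact: sqr_ge0.
have hA : 77 / 50 * (l - t) ^+ 2 * Gam / N <= A.
  have -> : A = 77 / 50 * Lam ^+ 2 * Gam * (kap / n) by rewrite /A; ring.
  apply: ler_pM => //; first by rewrite mulr_ge0// mulr_ge0 ?sqr_ge0.
    by rewrite invr_ge0 ltW.
  apply: ler_wpM2r => //; apply: ler_wpM2l => //.
  rewrite -real_normK ?num_real// lerXn2r ?nnegrE//.
  by apply: le_trans lL.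
pose l' := l - (l - t) / N; pose t' := t - 2 * t / N.
have hs : s i + 77 / 60 * (n / N) * (t + s i) ^+ 2 <= s i.+1.
  apply: le_trans (s_riccati ilt); rewrite lerD2l.
  have si := s_ge0 (ltnW ilt).
  apply: ler_pM; rewrite ?sqr_ge0//.
    by rewrite mulr_ge0// divr_ge0// ltW.
    by apply: ler_wpM2l.
  by apply: lerXn2r; rewrite ?nnegrE ?lerD2r// addr_ge0.
have := IH l' t' (ltnW jk); rewrite i1k => {}IH.
have t't : t' = t * (1 - 2 * N^-1) by rewrite /t'; ring.
have l't : l' - t' = (l - t) * (1 - N^-1) + 2 * t * N^-1 by rewrite /l' /t'; ring.
have {}IH : \sum_(S : {set V} | #|S| == c) expR (potential l' t' (s i.+1) S) <=
    'C(#|V|, c)%:R * expR (c%:R * A + D * (k%:R ^+ 2 - i.+1%:R ^+ 2)).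
  apply: IH.
  - apply/andP; split; first by rewrite t't mulr_ge0//; lra.
    by apply: le_trans tth; rewrite t't ler_piMr//; lra.
  - rewrite l't; apply: le_trans (ler_normD _ _) _.
    rewrite !normrM (ger0_norm (_ : 0 <= 1 - N^-1)); last by lra.
    rewrite (ger0_norm (ltW y0)) (ger0_norm t0) (ger0_norm (_ : 0 <= 2))//.
    have h1 : `|l - t| * (1 - N^-1) <= Lam * (1 - N^-1).
      by apply: ler_wpM2r => //; lra.
    have h2 : 2 * t * N^-1 <= Lam * N^-1.
      by apply: ler_wpM2r; [exact: ltW|move: Lam_large; lra].
    by move: (N^-1) h1 h2 => y h1 h2; lra.
  - case: small => [small|[lt small]]; [by left|right; split=> //].
    rewrite -natr1 addrK in lt; rewrite l't t't.
    have h : t * c%:R * (1 - N^-1) <= (l - t) * (1 - N^-1).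
      by apply: ler_wpM2r => //; lra.
    have h2 : 0 <= t * c%:R * N^-1 by rewrite !mulr_ge0// ltW.
    nra.
rewrite -(ler_pM2l (_ : 0 < c.+1%:R)) ?ltr0n// sum_subsets_succ.
apply: (@le_trans _ _ (\sum_(S : {set V} | #|S| == c)
    N * (expR (s i + A) * expR (potential l' t' (s i.+1) S)))).
  apply: ler_sum => S /eqP cS.
  have := @moment_step l t (s i) S N t0 (s_ge0 (ltnW ilt)).
  rewrite cS => /(_ erefl N0 smallc) => h; apply: le_trans h _.
  apply: ler_wpM2l; first exact: ltW.
  rewrite -expRD ler_expR addrC lerD//; first by rewrite lerD2l.
  by rewrite /potential lerD2l ler_wpM2r// energy_ge0.
rewrite -mulr_sumr -mulr_sumr.
have binE : c.+1%:R * 'C(#|V|, c.+1)%:R = N * 'C(#|V|, c)%:R.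
  rewrite -natrM mul_bin_left natrM /N /n natrB//.
  by rewrite -(ler_nat R); move: k_lt_n; rewrite /n; lra.
rewrite [leRHS]mulrA binE -[leRHS]mulrA; apply: ler_wpM2l; first exact: ltW.
apply: (@le_trans _ _ (expR (s i + A) * ('C(#|V|, c)%:R *
    expR (c%:R * A + D * (k%:R ^+ 2 - i.+1%:R ^+ 2))))).
  by rewrite ler_wpM2l ?expR_ge0.
rewrite mulrCA -expRD ler_wpM2l// ler_expR.
have := s_le (ltnW ilt); rewrite -[in c.+1%:R * A]natr1 mulrDl mul1r; lra.
Qed.

Lemma exp_moment (l : R) : `|l - th| <= Lam ->
  Lam + 2 * th * (k%:R - 1) + 2 * q <= 4 / 7 \/
    th * (k%:R - 1) <= l - th /\ Lam + 2 * q <= 4 / 7 ->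
  \sum_(S : {set V} | #|S| == k) expR (l * linpart S + th * quadpart S) <=
  'C(#|V|, k)%:R * expR (k%:R * (77 / 50 * kap * Lam ^+ 2 * Gam / n)
                         + D * k%:R ^+ 2).
Proof.
move=> lL small.
have := @moment_induction k l th (leqnn k) _ lL small; rewrite th_ge0 lexx.
rewrite subnn expr0n subr0 => /(_ isT) h; apply: le_trans h.
apply: ler_sum => S _; rewrite ler_expR /potential lerDl.
by rewrite mulr_ge0 ?energy_ge0 ?s_ge0.
Qed.

End Induction.
End ExponentialMoment.

(** * Degrees, edges inside a set, and the threshold *)

Lemma sqr_sum_le (R : realType) (I : finType) (x : I -> R) :
  (\sum_i x i) ^+ 2 <= #|I|%:R * \sum_i x i ^+ 2.
Proof.
have : 0 <= \sum_i \sum_j (x i - x j) ^+ 2.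
  by apply: sumr_ge0 => i _; apply: sumr_ge0 => j _; exact: sqr_ge0.
have -> : \sum_i \sum_j (x i - x j) ^+ 2 =
    2 * (#|I|%:R * \sum_i x i ^+ 2) - 2 * (\sum_i x i) ^+ 2.
  have E i : \sum_j (x i - x j) ^+ 2 =
      #|I|%:R * x i ^+ 2 - 2 * x i * (\sum_j x j) + \sum_j x j ^+ 2.
    transitivity (\sum_j (x i ^+ 2 - 2 * x i * x j + x j ^+ 2)).
      by apply: eq_bigr => j _; ring.
    by rewrite big_split/= sumrB sumr_const -mulr_sumr [in RHS]mulr_natl.
  under eq_bigr do rewrite E.
  rewrite big_split/= sumrB -!mulr_sumr sumr_const -mulr_suml -mulr_sumr.
  rewrite -[_ *+ #|I|]mulr_natl; ring.
lra.
Qed.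

Section Graph.
Variables (R : realType) (V : finType) (G : sgraph V).
Implicit Types (S : {set V}) (v w : V).

Definition adj v w : R := ([set v; w] \in edges G)%:R.
Definition deg v : R := \sum_w adj v w.
Definition degsum : R := \sum_v deg v.
Definition degsqsum : R := \sum_v deg v ^+ 2.
Definition edges_in S : nat := #|[set e in edges G | e \subset S]|.

Let n : R := #|V|%:R.

Definition gdeg v : R := (deg v - degsum / n) / n.
Definition kadj v w : R := adj v w - gdeg v - gdeg w - degsum / n ^+ 2.
Definition degvar : R := \sum_v gdeg v ^+ 2.

Lemma adj_sym v w : adj v w = adj w v.
Proof. by rewrite /adj setUC. Qed.

Lemma adj_diag v : adj v v = 0.
Proof.
rewrite /adj setUid; have [vE|//] := boolP ([set v] \in edges G).
by have /forall_inP/(_ _ vE) := @edges_pairs V G; rewrite cards1.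
Qed.

Lemma adj01 v w : 0 <= adj v w <= 1.
Proof. by rewrite /adj; case: (_ \in _); rewrite ?lexx ler01. Qed.

(** Each edge inside S is met by two ordered pairs of its ends. *)
Lemma edges_in_double S :
  \sum_(v in S) \sum_(w in S) adj v w = 2 * (edges_in S)%:R :> R.
Proof.
pose pairs := [set vw : V * V | [&& vw.1 \in S, vw.2 \in S & [set vw.1; vw.2] \in edges G]].
transitivity (#|pairs|%:R : R).
  rewrite pair_big_dep/= -sum1_card natr_sum big_mkcond [RHS]big_mkcond/=.
  apply: eq_bigr => -[v w] _; rewrite !inE/= /adj.
  by case: (v \in S); case: (w \in S); case: (_ \in edges G).
suff -> : #|pairs| = (2 * edges_in S)%N by rewrite natrM.
rewrite /edges_in mulnC -sum_nat_const -sum1_card.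
rewrite (partition_big (fun vw : V * V => [set vw.1; vw.2])
   (mem [set e in edges G | e \subset S]))/=; last first.
  move=> [v w]; rewrite !inE/= => /and3P[vS wS ->]/=.
  by rewrite subUset !sub1set vS.
apply: eq_bigr => e; rewrite inE => /andP[eE eS].
have /forall_inP/(_ _ eE)/cards2P[x [y [xy eD]]] := @edges_pairs V G.
rewrite sum1_card (_ : 2 = #|[set (x, y); (y, x)]|)%N; last first.
  by rewrite cards2 xpair_eqE negb_and xy.
apply: eq_card => -[v w]; rewrite !inE/= !xpair_eqE.
move: eS; rewrite eD subUset !sub1set => /andP[xS yS].
rewrite -topredE /= !inE /=; apply/andP/orP.
  move=> [/and3P[vS wS vwE] /eqP vwD].
  have vw : v != w.
    by apply: contraTneq vwE => ->; rewrite setUid; apply/negP => wE;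
       have := adj_diag w; rewrite /adj setUid wE => /eqP; rewrite oner_eq0.
  have : v \in [set x; y] by rewrite -vwD !inE eqxx.
  have : w \in [set x; y] by rewrite -vwD !inE eqxx orbT.
  rewrite !inE => /orP[] /eqP ? /orP[] /eqP ?; subst; rewrite ?eqxx in vw *.
  - by [].
  - by right.
  - by left.
  - by [].
case=> /andP[/eqP -> /eqP ->]; rewrite xS yS; split=> //.
- by rewrite -eD.
- by rewrite setUC -eD.
- by rewrite setUC.
Qed.

Hypothesis n_gt0 : 0 < n.

Let nn0 : n != 0. Proof. exact: lt0r_neq0. Qed.

Lemma sum_cst (c : R) : \sum_(v : V) c = n * c.
Proof. by rewrite sumr_const -mulr_natl. Qed.

Lemma deg_bounds v : 0 <= deg v <= n.
Proof.
apply/andP; split; first by apply: sumr_ge0 => w _; case/andP: (adj01 v w).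
rewrite -[leRHS]mulr1 -sum_cst; apply: ler_sum => w _.
by case/andP: (adj01 v w).
Qed.

Lemma degsum_bounds : 0 <= degsum <= n ^+ 2.
Proof.
apply/andP; split; first by apply: sumr_ge0 => w _; case/andP: (deg_bounds w).
by rewrite expr2 -sum_cst; apply: ler_sum => w _; case/andP: (deg_bounds w).
Qed.

Lemma gdeg_sum0 : \sum_v gdeg v = 0.
Proof.
rewrite -mulr_suml sumrB sum_cst -/degsum; apply/eqP.
by rewrite mulf_eq0 mulrC divfK// subrr eqxx.
Qed.

Lemma degE v : deg v = n * gdeg v + degsum / n.
Proof. by rewrite /gdeg; field. Qed.

Lemma gdeg_le1 v : `|gdeg v| <= 1.
Proof.
have h1 := deg_bounds v; have := degsum_bounds.
have -> : degsum = n * (degsum / n) by field.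
rewrite expr2 pmulr_rge0// ler_pM2l// => h2.
rewrite /gdeg normrM normfV (gtr0_norm n_gt0) ler_pdivrMr// mul1r ler_norml.
move: (degsum / n) h2 => a h2; lra.
Qed.

Lemma kadj_sym v w : kadj v w = kadj w v.
Proof. by rewrite /kadj adj_sym; ring. Qed.

Lemma kadj_row0 v : \sum_w kadj v w = 0.
Proof.
rewrite !sumrB !sum_cst gdeg_sum0 -/(deg v) degE; field; exact: nn0.
Qed.

Lemma kadjD v w : kadj v w + gdeg w = adj v w - deg v / n.
Proof. by rewrite /kadj degE; field. Qed.

Lemma kadjD_le1 v w : `|kadj v w + gdeg w| <= 1.
Proof.
rewrite kadjD; have := adj01 v w; have := deg_bounds v => /andP[h1 h2].
have h3 : 0 <= deg v / n by apply: divr_ge0 => //; exact: ltW.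
have h4 : deg v / n <= 1 by rewrite ler_pdivrMr// mul1r.
rewrite ler_norml; lra.
Qed.

Lemma kadj_diag v : kadj v v <= - 2 * gdeg v.
Proof.
rewrite /kadj adj_diag; have /andP[h _] := degsum_bounds.
have : 0 <= degsum / n ^+ 2 by rewrite divr_ge0// exprn_ge0// ltW.
lra.
Qed.

(** On vectors of sum 0 the adjacency entries may be replaced by their values
    minus 1/2, of absolute value 1/2; the centring by g then removes the mean of
    the image. *)
Lemma kadj_op (z : V -> R) : \sum_v z v = 0 ->
  \sum_v (\sum_w kadj v w * z w) ^+ 2 <= (n / 2) ^+ 2 * \sum_v z v ^+ 2.
Proof.
move=> z0.
pose a v := \sum_w (adj v w - 1 / 2) * z w.
pose c := \sum_w gdeg w * z w.
have aE v : \sum_w kadj v w * z w = a v - c.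
  rewrite /a /c -sumrB.
  transitivity (\sum_w (((adj v w - 1 / 2) * z w - gdeg w * z w)
       + (1 / 2 - gdeg v - degsum / n ^+ 2) * z w)).
    by apply: eq_bigr => w _; rewrite /kadj; ring.
  by rewrite big_split/= -mulr_sumr z0 mulr0 addr0.
have asum : \sum_v a v = n * c.
  rewrite exchange_big /c mulr_sumr.
  transitivity (\sum_w (n * (gdeg w * z w) + (degsum / n - n / 2) * z w)).
    apply: eq_bigr => w _; rewrite -mulr_suml sumrB sum_cst.
    rewrite (eq_bigr (fun v => adj w v)); last by move=> v _; exact: adj_sym.
    by rewrite -/(deg w) degE; field.
  by rewrite big_split/= -[X in _ + X]mulr_sumr z0 mulr0 addr0.
have -> : \sum_v (\sum_w kadj v w * z w) ^+ 2 = \sum_v a v ^+ 2 - n * c ^+ 2.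
  under eq_bigr do rewrite aE sqrrB.
  rewrite big_split/= sumrB sum_cst.
  rewrite (_ : \sum_i a i * c *+ 2 = 2 * (n * c ^+ 2)); first by ring.
  by rewrite sumrMnl -mulr_suml asum; ring.
apply: (@le_trans _ _ (\sum_v a v ^+ 2)).
  by rewrite gerBl mulr_ge0 ?sqr_ge0// ltW.
have av v : a v ^+ 2 <= n / 4 * \sum_w z w ^+ 2.
  apply: le_trans (sqr_sum_le _) _; rewrite -/n -mulrA; apply: ler_wpM2l; first exact: ltW.
  rewrite mulr_sumr; apply: ler_sum => w _.
  by rewrite /adj; case: (_ \in _) => /=; rewrite le_eqVlt; apply/orP; left; apply/eqP; field.
apply: le_trans (ler_sum _ (fun v _ => av v)) _.
by rewrite sum_cst le_eqVlt; apply/orP; left; apply/eqP; field.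
Qed.

(** As g has sum 0, the entries may again be replaced by +1/2 and -1/2. *)
Lemma adj_gdeg_ge : - (n / 2) * degvar <= \sum_u \sum_v adj u v * (gdeg u * gdeg v).
Proof.
have -> : \sum_u \sum_v adj u v * (gdeg u * gdeg v) =
    \sum_u \sum_v (adj u v - 1 / 2) * (gdeg u * gdeg v).
  have E : \sum_u \sum_v (1 / 2 : R) * (gdeg u * gdeg v) = 0.
    by apply: big1 => u _; rewrite -mulr_sumr -mulr_sumr gdeg_sum0; ring.
  rewrite -[LHS]subr0 -[X in _ - X]E -sumrB; apply: eq_bigr => u _.
  by rewrite -sumrB; apply: eq_bigr => v _; ring.
have -> : - (n / 2) * degvar =
    \sum_u \sum_v - (1 / 4) * (gdeg u ^+ 2 + gdeg v ^+ 2).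
  under eq_bigr => u _.
    rewrite -mulr_sumr big_split/= sum_cst -/degvar mulrDr; over.
  by rewrite big_split/= sum_cst -mulr_sumr -mulr_sumr -/degvar; field.
apply: ler_sum => u _; apply: ler_sum => v _.
have := sqr_ge0 (gdeg u + gdeg v); have := sqr_ge0 (gdeg u - gdeg v).
by rewrite sqrrB sqrrD /adj; case: (_ \in _) => /=; lra.
Qed.

Lemma degvarE : degvar = (degsqsum - degsum ^+ 2 / n) / n ^+ 2.
Proof.
rewrite /degvar /gdeg; under eq_bigr do rewrite expr_div_n sqrrB.
rewrite -mulr_suml big_split/= sumrB sum_cst -/degsqsum sumrMnl -mulr_suml -/degsum.
by field.
Qed.

Lemma edges_in_decomp S : (edges_in S)%:R =
  (#|S|%:R / n) ^+ 2 * degsum / 2 + #|S|%:R * linpart gdeg S + quadpart kadj S.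
Proof.
have := edges_in_double S.
have -> : \sum_(v in S) \sum_(w in S) adj v w =
    2 * quadpart kadj S + 2 * (#|S|%:R * linpart gdeg S)
    + #|S|%:R ^+ 2 * (degsum / n ^+ 2).
  have cst (c : R) : \sum_(w in S) c = #|S|%:R * c by rewrite sumr_const mulr_natl.
  transitivity (\sum_(v in S) (field kadj S v + #|S|%:R * gdeg v
      + (linpart gdeg S + #|S|%:R * (degsum / n ^+ 2)))).
    apply: eq_bigr => v _.
    transitivity (\sum_(w in S) (kadj w v + gdeg v + (gdeg w + degsum / n ^+ 2))).
      by apply: eq_bigr => w _; rewrite (kadj_sym w v) /kadj; ring.
    by rewrite big_split/= [X in X + _]big_split/= [X in _ + X]big_split/= !cst.
  rewrite !big_split/= !cst -mulr_sumr /quadpart -/(linpart gdeg S); field; exact: nn0.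
move=> h; apply: (@mulfI _ 2) => //; rewrite -h; field; exact: nn0.
Qed.

Lemma linpart_setC S : linpart gdeg (~: S) = - linpart gdeg S.
Proof.
have := gdeg_sum0; rewrite (bigID (mem S))/= => /eqP.
rewrite addrC addr_eq0 => /eqP <-.
by apply: eq_bigl => v; rewrite inE.
Qed.

Lemma quadpart_setC S : quadpart kadj (~: S) = quadpart kadj S.
Proof.
have compl (f : V -> R) : \sum_v f v = 0 -> \sum_(v in ~: S) f v = - \sum_(v in S) f v.
  rewrite (bigID (mem S))/= addrC => /eqP; rewrite addr_eq0 => /eqP <-.
  by apply: eq_bigl => v; rewrite inE.
have fC w : field kadj (~: S) w = - field kadj S w.
  apply: compl; under eq_bigr do rewrite kadj_sym; exact: kadj_row0.
rewrite /quadpart; congr (_ / 2); under eq_bigr do rewrite fC.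
by rewrite sumrN compl ?opprK// (field_sum0 kadj_row0).
Qed.

Lemma sum_subsets_setC (m : nat) (F : {set V} -> R) : (m <= #|V|)%N ->
  \sum_(S : {set V} | #|S| == m) F S =
  \sum_(S : {set V} | #|S| == (#|V| - m)%N) F (~: S).
Proof.
move=> mV; rewrite (reindex_inj (@setC_inj V))/=; apply: eq_bigl => S.
by move: mV (cardsC S) => mV <-; move: mV; rewrite -(cardsC S); move: #|S| #|~: S| => a b; lia.
Qed.

Definition half_size (m : nat) : nat := minn m (#|V| - m).

Definition threshold (m : nat) : R :=
  (m%:R / n) ^+ 2 * degsum / 2
  + 3 / 4 * ((half_size m)%:R / n) * m%:R * degvar - m%:R / 2.

Lemma half_size_le (m : nat) : (m <= #|V|)%N ->
  (half_size m)%:R <= m%:R :> R /\ (half_size m)%:R + m%:R <= n.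
Proof.
move=> mV; split; first by rewrite ler_nat geq_minl.
by rewrite -natrD ler_nat -(subnKC mV) addnC leq_add2l geq_minr.
Qed.

Lemma degvar_ge0 : 0 <= degvar.
Proof. by apply: sumr_ge0 => v _; exact: sqr_ge0. Qed.

(** The gain of the tilted point m/n + (k/n) g over the constant point is
    (k/n) m Gam in first order, and the second order term costs at most a quarter
    of that.  Adding the identity matrix makes the form convex along exchanges;
    on an m-set it contributes exactly m. *)
Lemma exists_dense (m : nat) : (m <= #|V|)%N ->
  exists S, #|S| = m /\ threshold m <= (edges_in S)%:R.
Proof.
move=> mV; have [km kmn] := half_size_le mV.
set k : R := (half_size m)%:R in km kmn; have k0 : 0 <= k by [].
pose y v : R := m%:R / n + k / n * gdeg v.
pose C v w : R := adj v w + (v == w)%:R.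
have Csym u v : C u v = C v u by rewrite /C adj_sym eq_sym.
have Cdiag v : C v v = 1 by rewrite /C adj_diag eqxx add0r.
have Cle1 u v : C u v <= 1.
  rewrite /C; case: eqVneq => [->|_]; first by rewrite adj_diag add0r.
  by rewrite addr0; case/andP: (adj01 u v).
have y01 v : 0 <= y v <= 1.
  have := gdeg_le1 v; rewrite ler_norml => /andP[g1 g2].
  have -> : y v = (m%:R + k * gdeg v) / n by rewrite /y; field.
  rewrite ler_pdivlMr// ler_pdivrMr// mul0r mul1r.
  by apply/andP; split; nra.
have ysum : \sum_v y v = m%:R.
  by rewrite big_split/= sum_cst -mulr_sumr gdeg_sum0; field.
have qC z : qform C z = qform adj z + \sum_v z v ^+ 2.
  rewrite /qform -big_split/=; apply: eq_bigr => u _.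
  under eq_bigr do rewrite mulrDl.
  rewrite big_split/=; congr (_ + _).
  rewrite (bigD1 u)//= eqxx mul1r big1 ?addr0 ?expr2// => v vu.
  by rewrite eq_sym (negbTE vu) mul0r.
have [S [cS]] := round_fractional Csym Cdiag Cle1 y01 ysum.
rewrite !qC => h; exists S; split=> //.
have indS : qform adj (fun v => (v \in S)%:R) = 2 * (edges_in S)%:R.
  rewrite -edges_in_double /qform [RHS]big_mkcond/=; apply: eq_bigr => u _.
  case: (u \in S); last by rewrite big1// => v _; rewrite mul0r mulr0.
  rewrite [RHS]big_mkcond/=; apply: eq_bigr => v _; rewrite mul1r.
  by case: (v \in S); rewrite ?mulr1 ?mulr0.
have indS2 : \sum_v ((v \in S)%:R : R) ^+ 2 = m%:R.
  rewrite -cS -sum1_card natr_sum [RHS]big_mkcond/=; apply: eq_bigr => v _.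
  by case: (v \in S); rewrite ?expr1n ?expr0n.
rewrite indS indS2 in h.
have y2 : 0 <= \sum_v y v ^+ 2 by apply: sumr_ge0 => v _; exact: sqr_ge0.
have qy : qform adj y = (m%:R / n) ^+ 2 * degsum + 2 * (m%:R * (k / n) * degvar)
   + (k / n) ^+ 2 * (\sum_u \sum_v adj u v * (gdeg u * gdeg v)).
  rewrite (qformD adj_sym (fun=> m%:R / n) (fun v => k / n * gdeg v)).
  congr (_ + 2 * _ + _).
  - rewrite /qform mulr_sumr; apply: eq_bigr => u _.
    by rewrite -mulr_suml -expr2 mulrC.
  - transitivity (\sum_u (m%:R * (k / n) * gdeg u ^+ 2
        + m%:R * (k / n) * (degsum / n ^+ 2) * gdeg u)).
      apply: eq_bigr => u _; rewrite -mulr_suml -/(deg u) degE; field; exact: nn0.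
    by rewrite big_split/= -!mulr_sumr gdeg_sum0 mulr0 addr0.
  - rewrite /qform mulr_sumr; apply: eq_bigr => u _.
    by rewrite mulr_sumr; apply: eq_bigr => v _; ring.
rewrite qy in h.
have hg := ler_wpM2l (sqr_ge0 (k / n)) adj_gdeg_ge.
have hk : (k / n) ^+ 2 * ((n / 2) * degvar) <= m%:R / 2 * (k / n) * degvar.
  have -> : (k / n) ^+ 2 * ((n / 2) * degvar) = k * (k / n * degvar / 2) by field.
  have -> : m%:R / 2 * (k / n) * degvar = m%:R * (k / n * degvar / 2) by ring.
  apply: ler_wpM2r => //; apply: divr_ge0 => //; apply: mulr_ge0.
    by apply: divr_ge0 => //; exact: ltW.
  exact: degvar_ge0.
rewrite /threshold -/k.
have -> : 3 / 4 * (k / n) * m%:R * degvar = 3 / 2 * (m%:R / 2 * (k / n) * degvar) by field.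
have E : m%:R * (k / n) * degvar = 2 * (m%:R / 2 * (k / n) * degvar) by field.
rewrite E in h; rewrite mulNr mulrN in hg.
move: (m%:R / 2 * (k / n) * degvar) ((k / n) ^+ 2 * _) ((k / n) ^+ 2 * _) h hg hk.
move=> a b c h hg hk.
lra.
Qed.

(** When m > n / 2 it is the complement that is revealed vertex by vertex, so that
    at most half of the vertices are ever used: complementation changes the sign
    of the linear part and preserves the quadratic part. *)
Lemma sum_expR_edges (m : nat) (th : R) : (m <= #|V|)%N ->
  let l := if (2 * m <= #|V|)%N then th * m%:R else - (th * m%:R) in
  \sum_(S : {set V} | #|S| == m) expR (th * (edges_in S)%:R) =
  expR (th * ((m%:R / n) ^+ 2 * degsum / 2)) *
  \sum_(S : {set V} | #|S| == half_size m)
     expR (l * linpart gdeg S + th * quadpart kadj S).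
Proof.
move=> mV.
have [m2|m2]/= := leqP (2 * m) #|V|.
  have hm : half_size m = m by rewrite /half_size; apply/minn_idPl; lia.
  rewrite hm mulr_sumr; apply: eq_bigr => S /eqP cS.
  rewrite -expRD edges_in_decomp cS; congr expR; ring.
have hm : half_size m = (#|V| - m)%N by rewrite /half_size; apply/minn_idPr; lia.
rewrite hm (sum_subsets_setC _ mV) mulr_sumr; apply: eq_bigr => S /eqP cS.
have cSC : #|~: S| = m by have := cardsC S; lia.
rewrite -expRD edges_in_decomp cSC linpart_setC quadpart_setC; congr expR; ring.
Qed.

Lemma bin_half_size (m : nat) : (m <= #|V|)%N -> 'C(#|V|, half_size m) = 'C(#|V|, m).
Proof. by move=> mV; rewrite /half_size; case: leqP => // _; exact: bin_sub. Qed.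

(** The linear cost 77/50 kap Lam^2 (k/n) Gam is paid by the second term of the
    threshold, and c + th m / 2 collects the total error of the induction and
    the rounding loss in the threshold. *)
Lemma moment_le_of_constants (m : nat) (th kap Lam q c : R) :
  let k : R := (half_size m)%:R in
  let al := 77 / 60 * kap in
  let l := if (2 * m <= #|V|)%N then th * m%:R else - (th * m%:R) in
  (m <= #|V|)%N -> 0 <= th -> 0 < kap -> k + 1 <= n -> n <= kap * (n - k + 1) ->
  al * th * k < 1 -> al * (th * (k - 1) + q) ^+ 2 <= 4 * q ->
  2 * th <= Lam -> `|l - th| <= Lam ->
  Lam + 2 * th * (k - 1) + 2 * q <= 4 / 7 \/
    th * (k - 1) <= l - th /\ Lam + 2 * q <= 4 / 7 ->
  77 / 50 * kap * Lam ^+ 2 <= 3 / 4 * (th * m%:R) ->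
  al * (th * k) ^+ 2 <= 2 * c * (1 - al * th * k) ->
  c + th * m%:R / 2 <= 13 / 20 ->
  \sum_(S : {set V} | #|S| == m) expR (th * (edges_in S)%:R) <=
  'C(#|V|, m)%:R * expR (th * threshold m + 13 / 20).
Proof.
move=> k al l mV th0 kap0 k1 nk alk qal thL lL small lin cst fin.
rewrite sum_expR_edges// -bin_half_size//.
have H := @exp_moment R V kadj gdeg n_gt0 kadj_sym kadj_row0 gdeg_sum0 gdeg_le1
  kadjD_le1 kadj_diag kadj_op th kap Lam q (half_size m) th0 kap0 k1 nk alk qal
  thL l lL small.
apply: le_trans (ler_wpM2l (expR_ge0 _) H) _.
rewrite mulrCA ler_wpM2l// -expRD ler_expR /threshold -/k -/degvar -/n -/al.
have kn0 : 0 <= k / n * degvar.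
  by rewrite mulr_ge0 ?degvar_ge0// divr_ge0// ltW.
have h1 := ler_wpM2r kn0 lin.
have h2 : al * th ^+ 2 / (2 * (1 - al * th * k)) * k ^+ 2 <= c.
  rewrite mulrAC ler_pdivrMr; last by rewrite mulr_gt0// subr_gt0.
  have -> : al * th ^+ 2 * k ^+ 2 = al * (th * k) ^+ 2 by ring.
  by move: cst; lra.
have -> : k * (77 / 50 * kap * Lam ^+ 2 * degvar / n) =
  77 / 50 * kap * Lam ^+ 2 * (k / n * degvar) by ring.
have E : th * ((m%:R / n) ^+ 2 * degsum / 2 + 3 / 4 * (k / n) * m%:R * degvar - m%:R / 2)
  = th * ((m%:R / n) ^+ 2 * degsum / 2) + 3 / 4 * (th * m%:R) * (k / n * degvar)
    - th * m%:R / 2 by ring.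
rewrite E; lra.
Qed.

(** For gamma = 6/100 the smaller side may be the complement, and the coefficients
    are small enough to be added.  For gamma = 18/100 the
    inequality n >= 4 m gives kap = 4/3 and makes S itself the smaller side, so
    l = th m and l - t = t (m - 1); the constants are nearly tight. *)
Lemma moment_bound (gamma th : R) (m : nat) :
  (1 < m <= #|V|)%N -> admissible gamma #|V| m ->
  (gamma = 6 / 100 -> (11 <= m)%N) ->
  th = 2 * gamma / (m%:R - 1) ->
  \sum_(S : {set V} | #|S| == m) expR (th * (edges_in S)%:R) <=
  'C(#|V|, m)%:R * expR (th * threshold m + 13 / 20).
Proof.
move=> /andP[m1 mV] adm m11 thD.
have mR : m%:R <= n by rewrite ler_nat.
have [km kmn] := half_size_le mV.
have k0 : 0 <= (half_size m)%:R :> R by [].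
case: adm => [gE|[gE m4 m10]].
  have {m11}m11 : 11 <= m%:R :> R by rewrite ler_nat m11.
  pose x : R := (m%:R - 1)^-1.
  have mx : m%:R * x = 1 + x by rewrite /x; field; lra.
  have x0 : 0 < x by rewrite invr_gt0; lra.
  have x1 : x <= 1 / 10 by rewrite -[x]mul1r ler_pdivrMr; lra.
  have thE : th = 12 / 100 * x by rewrite thD gE /x; ring.
  have thm : th * m%:R = 12 / 100 + 12 / 100 * x by rewrite thE mulrAC -mulrA mx; ring.
  have th0 : 0 <= th by rewrite thE; lra.
  have thk : th * (half_size m)%:R <= th * m%:R by exact: ler_wpM2l.
  have thk0 : 0 <= th * (half_size m)%:R by exact: mulr_ge0.
  apply: (@moment_le_of_constants m th 2 (144 / 1000) (1 / 20) (4 / 100)) => //; try lra.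
  - rewrite mulrBr mulr1.
    set u := th * _ - th + 1 / 20.
    have u1 : - (17 / 100) <= u <= 17 / 100 by rewrite /u; lra.
    nra.
  - by case: ifP => _; rewrite ler_norml; lra.
  - move: (th * (half_size m)%:R) thk thk0 => y yk y0.
    nra.
have {m10}m10 : 10 <= m%:R :> R by rewrite ler_nat.
have hm : half_size m = m by rewrite /half_size; apply/minn_idPl; lia.
have m2 : (2 * m <= #|V|)%N by lia.
have {m4}m4 : 4 * m%:R <= n by rewrite -natrM ler_nat.
pose x : R := (m%:R - 1)^-1.
have mx : m%:R * x = 1 + x by rewrite /x; field; lra.
have x0 : 0 < x by rewrite invr_gt0; lra.
have x1 : x <= 1 / 9 by rewrite -[x]mul1r ler_pdivrMr; lra.
have thE : th = 36 / 100 * x by rewrite thD gE /x; ring.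
have thm : th * m%:R = 36 / 100 + 36 / 100 * x by rewrite thE mulrAC -mulrA mx; ring.
have th0 : 0 <= th by rewrite thE; lra.
apply: (@moment_le_of_constants m th (4 / 3) (36 / 100) (1 / 10) (44 / 100)) => //;
  rewrite ?hm ?m2; try lra.
- have -> : th * (m%:R - 1) = 36 / 100 by rewrite mulrBr mulr1 thm thE; lra.
  lra.
- by rewrite ler_norml; lra.
- by nra.
Qed.
End Graph.

(** * Running programs with a time bound *)

Section Execution.
Variable R : realType.
Implicit Types (s : memory R) (c : cmd) (b : test).

Definition runs c s (T : nat) (post : memory R -> Prop) : Prop :=
  exists t s', [/\ exec c s t s', (t <= T)%N & post s'].

Lemma runs_seq c1 c2 s T1 T2 (mid post : memory R -> Prop) :
  runs c1 s T1 mid -> (forall s', mid s' -> runs c2 s' T2 post) ->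
  runs (Seq c1 c2) s (T1 + T2) post.
Proof.
move=> [t1 [s1 [E1 t1T /[swap] H /H]]] [t2 [s2 [E2 t2T p2]]].
by exists (t1 + t2)%N, s2; split=> //; [exact: exec_seq E1 E2|exact: leq_add].
Qed.

Lemma runs_rstore a e s (post : memory R -> Prop) :
  post (rstore s (ieval s a) (reval s e)) ->
  runs (RStore a e) s (icost a + rcost e).+1 post.
Proof. by move=> p; do 2 eexists; split; [exact: exec_rstore|exact: leqnn|]. Qed.

Lemma runs_istore a e s (post : memory R -> Prop) :
  post (istore s (ieval s a) (ieval s e)) ->
  runs (IStore a e) s (icost a + icost e).+1 post.
Proof. by move=> p; do 2 eexists; split; [exact: exec_istore|exact: leqnn|]. Qed.

Lemma runs_rstore_seq a e c s T (post : memory R -> Prop) :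
  runs c (rstore s (ieval s a) (reval s e)) T post ->
  runs (Seq (RStore a e) c) s ((icost a + rcost e).+1 + T) post.
Proof. by move=> r; apply: runs_seq (runs_rstore (erefl _)) _ => _ <-. Qed.

Lemma runs_istore_seq a e c s T (post : memory R -> Prop) :
  runs c (istore s (ieval s a) (ieval s e)) T post ->
  runs (Seq (IStore a e) c) s ((icost a + icost e).+1 + T) post.
Proof. by move=> r; apply: runs_seq (runs_istore (erefl _)) _ => _ <-. Qed.

Lemma runs_if b c1 c2 s T (post : memory R -> Prop) :
  runs (if teval s b then c1 else c2) s T post ->
  runs (If b c1 c2) s (tcost b + T) post.
Proof.
move=> [t [s' [E tT p]]]; exists (tcost b + t)%N, s'.
by split=> //; [exact: exec_if|rewrite leq_add2l].
Qed.

(** A loop that is known to make exactly N turns. *)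
Lemma runs_while b c (N T : nat) (inv : nat -> memory R -> Prop) s :
  (forall i s, (i < N)%N -> inv i s -> teval s b /\ runs c s T (inv i.+1)) ->
  (forall s, inv N s -> ~~ teval s b) ->
  inv 0%N s -> runs (While b c) s (N * (tcost b + T) + tcost b) (inv N).
Proof.
move=> step stop inv0.
suff H d i s' : (i + d = N)%N -> inv i s' ->
    runs (While b c) s' (d * (tcost b + T) + tcost b) (inv N).
  exact: (H N 0%N).
elim: d i s' => [|d IH] i s'.
  rewrite addn0 => -> invN; exists (tcost b), s'; split=> //.
  exact: exec_while_stop (stop _ invN).
move=> iN invi; have iltN : (i < N)%N by lia.
have [bs [t1 [s1 [E1 t1T inv1]]]] := step _ _ iltN invi.
have [t2 [s2 [E2 t2T inv2]]] := IH i.+1 s1 ltac:(lia) inv1.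
exists (tcost b + t1 + t2)%N, s2; split=> //; first exact: exec_while_step E1 E2.
rewrite mulSn; lia.
Qed.

Lemma runs_weaken c s T T' (post post' : memory R -> Prop) :
  (T <= T')%N -> (forall s', post s' -> post' s') ->
  runs c s T post -> runs c s T' post'.
Proof.
move=> TT pp [t [s' [E tT p]]]; exists t, s'; split=> //; last exact: pp.
exact: leq_trans TT.
Qed.

End Execution.

(** * The program *)

(** The real cells hold: 2, 3 the numbers n, m; 4, 5 the sum of the degrees and the
    sum of their squares; 6, 8 the row and column counters; 7 the current row sum;
    9 the number min (m, n - m).  The adjacency matrix starts at integer cell 2, so
    the counters are real numbers and integer cell 1, freed by copying m, is the
    read pointer, the only computed address. *)
Definition creal (i : nat) : rexp := RLoad (IConst i).
Definition cnum (i : nat) : rexp := RInt (IConst i).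
Definition set_creal (i : nat) (e : rexp) : cmd := RStore (IConst i) e.

Definition scan_entry : cmd :=
  Seq (set_creal 7 (RAdd (creal 7) (RInt (ILoad (ILoad (IConst 1))))))
 (Seq (IStore (IConst 1) (IAdd (ILoad (IConst 1)) (IConst 1)))
      (set_creal 8 (RAdd (creal 8) (cnum 1)))).

Definition scan_row : cmd :=
  Seq (set_creal 7 (cnum 0))
 (Seq (set_creal 8 (cnum 0))
 (Seq (While (RLt (creal 8) (creal 2)) scan_entry)
 (Seq (set_creal 4 (RAdd (creal 4) (creal 7)))
 (Seq (set_creal 5 (RAdd (creal 5) (RMul (creal 7) (creal 7))))
      (set_creal 6 (RAdd (creal 6) (cnum 1))))))).

Definition threshold_rexp : rexp :=
  RSub (RAdd
    (RDiv (RMul (RMul (RDiv (creal 3) (creal 2)) (RDiv (creal 3) (creal 2))) (creal 4))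
          (cnum 2))
    (RMul (RMul (RMul (RDiv (cnum 3) (cnum 4)) (RDiv (creal 9) (creal 2))) (creal 3))
          (RDiv (RSub (creal 5) (RDiv (RMul (creal 4) (creal 4)) (creal 2)))
                (RMul (creal 2) (creal 2)))))
    (RDiv (creal 3) (cnum 2)).

Definition target_rexp : rexp :=
  RMul (creal 0) (RDiv (RMul (creal 3) (RSub (creal 3) (cnum 1))) (cnum 2)).

Definition program : cmd :=
  Seq (set_creal 2 (RInt (ILoad (IConst 0))))
 (Seq (set_creal 3 (RInt (ILoad (IConst 1))))
 (Seq (IStore (IConst 1) (IConst 2))
 (Seq (While (RLt (creal 6) (creal 2)) scan_row)
 (Seq (If (RLt (creal 3) (RSub (creal 2) (creal 3)))
          (set_creal 9 (creal 3)) (set_creal 9 (RSub (creal 2) (creal 3))))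
      (If (RLt target_rexp threshold_rexp)
          (IStore (IConst 0) (IConst 0)) (IStore (IConst 0) (IConst 1))))))).

Section Program.
Variables (R : realType) (n m : nat) (G : sgraph 'I_n) (sigma eps : R).
Implicit Types s : memory R.

(** A cell belongs to a single pair (i, j) because j < n. *)
Lemma input_entry (i j : 'I_n) :
  imem (input m G sigma eps) (2 + n * i + j) = ([set i; j] \in edges G).
Proof.
rewrite /= -addnA !addSn /=; congr nat_of_bool.
apply/existsP/idP => [[i' /existsP[j' /andP[/eqP E]]]|ijE]; last first.
  by exists i; apply/existsP; exists j; rewrite eqxx.
have E' : (i * n + j = i' * n + j')%N.
  by move: E; rewrite add0n mulnC (mulnC n); lia.
have n0 : (0 < n)%N by apply: leq_ltn_trans (ltn_ord i).
have ii : i = i' by apply: val_inj; have := congr1 (divn^~ n) E';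
  rewrite /= !divnMDl// !divn_small// !addn0.
have jj : j = j' by apply: val_inj; have := congr1 (modn^~ n) E';
  rewrite /= !modnMDl !modn_small.
by rewrite ii jj.
Qed.

Let W (a : nat) : nat := imem (input m G sigma eps) a.

Definition row_sum (i : nat) : R := \sum_(j < n) (W (2 + n * i + j))%:R.

Definition frame s : Prop :=
  [/\ forall a, (1 < a)%N -> imem s a = W a, rmem s 0 = sigma,
      rmem s 2 = n%:R & rmem s 3 = m%:R].

Definition row_inv (i j : nat) s : Prop :=
  [/\ frame s, imem s 1 = (2 + n * i + j)%N,
      [/\ rmem s 4 = \sum_(y < i) row_sum y, rmem s 5 = \sum_(y < i) row_sum y ^+ 2
        & rmem s 6 = i%:R],
      rmem s 7 = \sum_(x < j) (W (2 + n * i + x))%:R & rmem s 8 = j%:R].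

Definition table_inv (i : nat) s : Prop :=
  [/\ frame s, imem s 1 = (2 + n * i)%N,
      rmem s 4 = \sum_(y < i) row_sum y, rmem s 5 = \sum_(y < i) row_sum y ^+ 2
    & rmem s 6 = i%:R].

Lemma runs_scan_entry i j s : row_inv i j s -> runs scan_entry s 22 (row_inv i j.+1).
Proof.
move=> [[fW f0 f2 f3] p [h4 h5 h6] h7 h8].
apply: (@runs_weaken _ _ _ _ _ (row_inv i j.+1)); last first.
- apply: runs_rstore_seq; apply: runs_istore_seq; apply: runs_rstore.
  split=> /=.
  + split=> //= a a1; rewrite -fW//.
    by case: a a1 => [|[|a]].
  + by rewrite p; lia.
  + by split.
  + by rewrite big_ord_recr/= h7 p fW.
  + by rewrite h8 natr1.
- by [].
- by [].
Qed.

Lemma runs_scan_row i s : table_inv i s ->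
  runs scan_row s (27 * n + 50) (table_inv i.+1).
Proof.
move=> [[fW f0 f2 f3] p h4 h5 h6].
apply: (@runs_weaken _ _ _ _ _ (table_inv i.+1)); last first.
- apply: runs_rstore_seq; apply: runs_rstore_seq.
  apply: runs_seq.
    apply: (@runs_while _ _ _ n 22 (row_inv i)) => [j s' jn inv|s' [[_ _ e2 _] _ _ _ e8]|].
    + split; last exact: runs_scan_entry.
      by case: inv => [[_ _ e2 _] _ _ _ e8]; rewrite /= e2 e8 ltr_nat.
    + by rewrite /= e2 e8 ltxx.
    + by split=> //=; rewrite ?addn0 ?big_ord0.
  move=> s' [[gW g0 g2 g3] q [e4 e5 e6] e7 e8].
  apply: runs_rstore_seq; apply: runs_rstore_seq; apply: runs_rstore.
  split=> //=.
  + by rewrite q; lia.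
  + by rewrite e4 e7 big_ord_recr.
  + by rewrite e5 e7 big_ord_recr/= -expr2.
  + by rewrite e6 natr1.
- by [].
- by rewrite /=; lia.
Qed.

Let M := \sum_(y < n) row_sum y.
Let D := \sum_(y < n) row_sum y ^+ 2.

Definition threshold_value : R :=
  (m%:R / n%:R) ^+ 2 * M / 2
  + 3 / 4 * ((minn m (n - m))%:R / n%:R) * m%:R * ((D - M ^+ 2 / n%:R) / n%:R ^+ 2)
  - m%:R / 2.

Lemma runs_program : (m <= n)%N ->
  runs program (input m G sigma eps) (n * (27 * n + 55) + 200)
    (fun s => output s =
       if sigma * (m%:R * (m%:R - 1) / 2) < threshold_value then 0%N else 1%N).
Proof.
move=> mn.
set post := (X in runs _ _ _ X).
apply: (@runs_weaken _ _ _ _ _ post); last first.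
- apply: runs_rstore_seq; apply: runs_rstore_seq; apply: runs_istore_seq.
  apply: runs_seq.
    apply: (@runs_while _ _ _ n (27 * n + 50) table_inv)
      => [i s jn inv|s [[_ _ e2 _] _ _ _ e6]|].
    + split; last exact: runs_scan_row.
      by case: inv => [[_ _ e2 _] _ _ _ e6]; rewrite /= e2 e6 ltr_nat.
    + by rewrite /= e2 e6 ltxx.
    + split=> //=; rewrite ?big_ord0 ?muln0//.
      by split=> //= -[|[|a]].
  move=> s [[fW f0 f2 f3] _ h4 h5 h6].
  pose mid s' := [/\ rmem s' 0 = sigma, rmem s' 2 = n%:R, rmem s' 3 = m%:R,
     rmem s' 4 = M & rmem s' 5 = D /\ rmem s' 9 = (minn m (n - m))%:R].
  apply: (@runs_seq _ _ _ _ _ _ mid).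
    apply: (@runs_if _ _ _ _ _ 20); rewrite /= f2 f3 -natrB// ltr_nat.
    case: ifP => h.
      apply: (@runs_weaken _ _ _ _ _ mid) (runs_rstore _) => //.
      by split=> //=; split=> //=; rewrite f3 /minn h.
    apply: (@runs_weaken _ _ _ _ _ mid) (runs_rstore _) => //.
    by split=> //=; split=> //=; rewrite f2 f3 -natrB// /minn h.
  move=> s' [e0 e2 e3 e4 [e5 e9]].
  apply: runs_if.
  have -> : teval s' (RLt target_rexp threshold_rexp) =
      (sigma * (m%:R * (m%:R - 1) / 2) < threshold_value).
    by rewrite /= e0 e2 e3 e4 e5 e9 /threshold_value !expr2.
  rewrite /post; case: ifP => _; exact: runs_istore.
- by [].
- by rewrite /=; lia.
Qed.

End Program.

(** * The two cases and the distinguishing algorithm *)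

Lemma threshold_valueE (R : realType) (n m : nat) (G : sgraph 'I_n) (sigma eps : R) :
  (0 < n)%N -> threshold_value m G sigma eps = threshold R G m.
Proof.
move=> n0.
have rowE (i : 'I_n) : row_sum m G sigma eps i = deg R G i.
  by apply: eq_bigr => j _; rewrite input_entry.
rewrite /threshold /threshold_value /half_size degvarE ?card_ord ?ltr0n//.
have -> : \sum_(y < n) row_sum m G sigma eps y = degsum R G.
  by apply: eq_bigr => i _; exact: rowE.
have -> // : \sum_(y < n) row_sum m G sigma eps y ^+ 2 = degsqsum R G.
by apply: eq_bigr => i _; rewrite rowE.
Qed.

Section Densities.
Variables (R : realType) (V : finType) (G : sgraph V).
Implicit Types S : {set V}.

Lemma bin2R (m : nat) : 'C(m, 2)%:R = m%:R * (m%:R - 1) / 2 :> R.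
Proof.
case: m => [|m]; first by rewrite bin0n !mul0r.
have E : ('C(m.+1, 2) * 2 = m.+1 * m)%N by rewrite (bin_ffact m.+1 2) ffactnS ffactn1.
have -> : m.+1%:R - 1 = m%:R :> R by rewrite -natr1 addrK.
by rewrite -natrM -E natrM mulfK.
Qed.

Lemma density_edges_in (m : nat) S : (1 < m)%N -> #|S| = m ->
  (edges_in G S)%:R = density R G S * 'C(m, 2)%:R.
Proof.
move=> m1 cS; rewrite /density cS divfK// pnatr_eq0 -lt0n bin_gt0.
exact: m1.
Qed.

Lemma density01 S : 0 <= density R G S <= 1.
Proof.
rewrite /density divr_ge0//=.
have [->|/eqP C0] := eqVneq 'C(#|S|, 2) 0%N; first by rewrite invr0 mulr0.
rewrite ler_pdivrMr ?mul1r ?ler_nat ?ltr0n ?lt0n; last exact/eqP.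
rewrite -cards_draws; apply/subset_leq_card/subsetP => e; rewrite !inE.
move=> /andP[eE ->]/=.
by have /forall_inP/(_ _ eE) := @edges_pairs V G.
Qed.

Lemma sum_const_draws (m : nat) (c : R) :
  \sum_(S : {set V} | #|S| == m) c = 'C(#|V|, m)%:R * c.
Proof.
rewrite -card_draws mulr_natl -sumr_const; apply: eq_bigl => S.
by rewrite inE.
Qed.

Definition dense_count (m : nat) (s : R) : nat :=
  #|[set S : {set V} | (#|S| == m) && (s <= density R G S)]|.

Lemma many_dense_count (gamma : R) (m : nat) (sigma eps : R) : (m <= #|V|)%N ->
  many_dense_subsets G gamma m sigma eps ->
  2 * expR (- (gamma * eps * m%:R)) * 'C(#|V|, m)%:R <= (dense_count m (sigma + eps))%:R.
Proof.
move=> mV; rewrite /many_dense_subsets /prob_dense card_draws.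
by rewrite ler_pdivlMr// ltr0n bin_gt0.
Qed.

(** Markov's inequality for the counting measure on m-sets. *)
Lemma dense_count_sum (m : nat) (s c : R) (F : {set V} -> R) :
  (forall S, 0 <= F S) ->
  (forall S, #|S| = m -> s <= density R G S -> c <= F S) ->
  (dense_count m s)%:R * c <= \sum_(S : {set V} | #|S| == m) F S.
Proof.
move=> F0 cF; rewrite mulr_natl -sumr_const.
rewrite [leRHS](bigID (fun S => s <= density R G S))/=.
apply: (@le_trans _ _ (\sum_(S : {set V} | (#|S| == m) && (s <= density R G S)) F S)).
  rewrite (eq_bigl (fun S => (#|S| == m) && (s <= density R G S))); last first.
    by move=> S; rewrite inE.
  by apply: ler_sum => S /andP[/eqP cS sS]; exact: cF.
by rewrite lerDl sumr_ge0.
Qed.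

Lemma dense_count_le (m : nat) (s : R) : (dense_count m s <= 'C(#|V|, m))%N.
Proof.
rewrite -card_draws; apply/subset_leq_card/subsetP => S; rewrite !inE.
by case/andP.
Qed.

Lemma admissible_bounds (gamma : R) (m : nat) :
  admissible gamma #|V| m -> 0 < gamma <= 18 / 100.
Proof. by case=> [->|[-> _ _]]; lra. Qed.

(** The exponent of the weight is gamma m t + (t - 1) N (u - 2 x) with
    0 <= N (u - 2 x) <= N x^3 <= 1 / m, as N is of order m^2 and x of order 1 / m. *)
Lemma weight_bounds (gamma : R) (m : nat) S : (1 < m)%N ->
  0 < gamma <= 18 / 100 ->
  expR (gamma * m%:R * density R G S - 1 / m%:R) <= weight G gamma m S
    <= expR (gamma * m%:R * density R G S).
Proof.
move=> m1 /andP[g0 g1].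
have {}m1 : 2 <= m%:R :> R by rewrite ler_nat.
have /andP[t0 t1] := density01 S; set t := density R G S in t0 t1 *.
set x := gamma / (m%:R - 1).
have x0 : 0 < x by rewrite divr_gt0//; lra.
have xg : x * (m%:R - 1) = gamma by rewrite /x divfK//; lra.
have xle : x <= 1 / 2 by rewrite /x ler_pdivrMr; lra.
have := @ln_ratio_bounds R x; rewrite (ltW x0) xle => /(_ isT).
set u := ln _ - ln _ => /andP[u1 u2].
set N : R := 'C(m, 2)%:R.
have NE : N = m%:R * (m%:R - 1) / 2 by exact: bin2R.
have -> : weight G gamma m S = expR (gamma * m%:R + (t - 1) * N * u).
  rewrite /weight -/t -/x -/N /powR !gt_eqF; [|lra|lra].
  rewrite -!expRD; congr expR; rewrite /u; ring.
rewrite !ler_expR.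
have E : gamma * m%:R + (t - 1) * N * (2 * x) = gamma * m%:R * t.
  by rewrite NE -xg; field.
have N0 : 0 <= N by [].
have up : (t - 1) * N * u <= (t - 1) * N * (2 * x).
  rewrite -!mulrA ler_wnM2l//; first by lra.
  exact: ler_wpM2l.
have err : N * x ^+ 3 <= 1 / m%:R.
  rewrite NE ler_pdivlMr; last by lra.
  have -> : m%:R * (m%:R - 1) / 2 * x ^+ 3 * m%:R = m%:R ^+ 2 * x ^+ 2 * (x * (m%:R - 1)) / 2.
    by ring.
  have mx : m%:R * x <= 2 * gamma by rewrite -xg; nra.
  have mx0 : 0 <= m%:R * x by rewrite mulr_ge0// ltW.
  rewrite xg -exprMn; move: (m%:R * x) mx mx0 => y yg y0.
  nra.
have low : (t - 1) * N * (2 * x) - N * x ^+ 3 <= (t - 1) * N * u.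
  have h : (1 - t) * (N * (u - 2 * x)) <= N * (u - 2 * x).
    by rewrite ler_piMl ?mulr_ge0//; lra.
  have h2 : N * (u - 2 * x) <= N * x ^+ 3 by apply: ler_wpM2l => //; lra.
  lra.
by apply/andP; split; lra.
Qed.

Lemma Density_upper (gamma : R) (m : nat) (sigma : R) :
  (1 < m)%N -> admissible gamma #|V| m -> no_dense_subset G m sigma ->
  Density G gamma m <= 'C(#|V|, m)%:R * expR (gamma * m%:R * sigma + 1 / m%:R).
Proof.
move=> m1 /admissible_bounds g nd; rewrite -sum_const_draws.
apply: ler_sum => S /eqP cS.
have /andP[_ h] := weight_bounds S m1 g; apply: le_trans h _.
rewrite ler_expR; apply: (@le_trans _ _ (gamma * m%:R * sigma)); last by rewrite lerDl.
apply: ler_wpM2l; first by rewrite mulr_ge0//; lra.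
by rewrite leNgt; apply/negP => /ltW; exact: nd.
Qed.

Lemma Density_lower (gamma : R) (m : nat) (sigma eps : R) :
  (1 < m <= #|V|)%N -> admissible gamma #|V| m ->
  many_dense_subsets G gamma m sigma eps ->
  2 * 'C(#|V|, m)%:R * expR (gamma * m%:R * sigma - 1 / m%:R) <= Density G gamma m.
Proof.
move=> /andP[m1 mV] /admissible_bounds g /(many_dense_count mV) cnt.
have gm : 0 <= gamma * m%:R by rewrite mulr_ge0//; lra.
pose c := expR (gamma * m%:R * (sigma + eps) - 1 / m%:R).
apply: (@le_trans _ _ ((dense_count m (sigma + eps))%:R * c)).
  apply: le_trans (ler_wpM2r (expR_ge0 _) cnt).
  rewrite [leRHS]mulrAC -[_ * expR _ * c]mulrA -expRD.
  rewrite le_eqVlt; apply/orP; left; apply/eqP.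
  have -> : - (gamma * eps * m%:R) + (gamma * m%:R * (sigma + eps) - 1 / m%:R)
     = gamma * m%:R * sigma - 1 / m%:R by ring.
  by ring.
apply: dense_count_sum => [S|S cS dS].
  by rewrite /weight !mulr_ge0 ?expR_ge0 ?powR_ge0.
have /andP[h _] := weight_bounds S m1 g; apply: le_trans h.
by rewrite ler_expR lerD2r ler_wpM2l.
Qed.

Lemma threshold_of_no_dense (m : nat) (sigma : R) : (1 < m <= #|V|)%N ->
  no_dense_subset G m sigma -> threshold R G m <= sigma * 'C(m, 2)%:R.
Proof.
move=> /andP[m1 mV] nd.
have n0 : 0 < #|V|%:R :> R by rewrite ltr0n; lia.
have [S [cS h]] := exists_dense G n0 mV; apply: le_trans h _.
rewrite (density_edges_in m1 cS) ler_wpM2r//.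
by rewrite leNgt; apply/negP => /ltW; exact: nd.
Qed.

(** A proportion of at most 1 forces gamma eps m >= ln 2 > 13/20; for gamma = 6/100
    this excludes m <= 10.  For larger m the moment bound and Markov's inequality
    give 2 exp (th sigma N) <= exp (th T + 13/20) < 2 exp (th T). *)
Lemma threshold_of_many_dense (gamma : R) (m : nat) (sigma eps : R) :
  (1 < m <= #|V|)%N -> admissible gamma #|V| m -> 0 <= sigma -> 0 <= eps ->
  sigma + eps <= 1 -> many_dense_subsets G gamma m sigma eps ->
  sigma * 'C(m, 2)%:R < threshold R G m.
Proof.
move=> mV adm s0 e0 se1 /[dup] md; case/andP: (mV) => m1 mV'.
move=> /(many_dense_count mV') cnt.
have n0 : 0 < #|V|%:R :> R by rewrite ltr0n; lia.
have B0 : 0 < 'C(#|V|, m)%:R :> R by rewrite ltr0n bin_gt0.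
have e2 := @expR_13_20_lt2 R.
have m2 : 2 <= m%:R :> R by rewrite ler_nat.
have m11 : gamma = 6 / 100 -> (11 <= m)%N.
  move=> gE; rewrite leqNgt; apply/negP => m10.
  have {}m10 : m%:R <= 10 :> R by rewrite ler_nat.
  have : 2 * expR (- (gamma * eps * m%:R)) * 'C(#|V|, m)%:R <= 'C(#|V|, m)%:R.
    by apply: le_trans cnt _; rewrite ler_nat dense_count_le.
  rewrite -[leRHS]mul1r ler_pM2r// expRN ler_pdivrMr ?expR_gt0// mul1r.
  have : expR (gamma * eps * m%:R) <= expR (13 / 20 : R).
    by rewrite ler_expR gE; nra.
  lra.
set th : R := 2 * gamma / (m%:R - 1).
have thN : th * 'C(m, 2)%:R = gamma * m%:R.
  by rewrite bin2R /th; field; lra.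
have th0 : 0 < th.
  by have /andP[g0 _] := admissible_bounds adm; rewrite divr_gt0 ?mulr_gt0//; lra.
have mom := moment_bound G n0 mV adm m11 (erefl th).
have low : (dense_count m (sigma + eps))%:R * expR (th * ((sigma + eps) * 'C(m, 2)%:R))
    <= \sum_(S : {set V} | #|S| == m) expR (th * (edges_in G S)%:R).
  apply: dense_count_sum => [S|S cS dS]; first exact: expR_ge0.
  rewrite ler_expR (density_edges_in m1 cS); apply: ler_wpM2l; first exact: ltW.
  exact: ler_wpM2r.
have := le_trans (le_trans (ler_wpM2r (expR_ge0 _) cnt) low) mom.
set A := expR (th * _); set Z := expR (th * threshold R G m + _) => h.
have {}h : 2 * (expR (- (gamma * eps * m%:R)) * A) <= Z.
  rewrite -(ler_pM2l B0); apply: le_trans h.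
  by rewrite le_eqVlt; apply/orP; left; apply/eqP; ring.
have AE : expR (- (gamma * eps * m%:R)) * A = expR (th * (sigma * 'C(m, 2)%:R)).
  rewrite /A -expRD; congr expR.
  have -> : th * ((sigma + eps) * 'C(m, 2)%:R) = (sigma + eps) * (th * 'C(m, 2)%:R) by ring.
  have -> : th * (sigma * 'C(m, 2)%:R) = sigma * (th * 'C(m, 2)%:R) by ring.
  by rewrite thN; ring.
rewrite AE in h.
rewrite -(ltr_pM2l th0) -ltr_expR -(ltr_pM2l (ltr0n R 2)).
apply: le_lt_trans h _; rewrite /Z expRD mulrC ltr_pM2r ?expR_gt0//.
Qed.

End Densities.

Theorem mainTheorem4 (R : realType) :
  exists K L : R, forall gamma : R,
    (forall (sigma eps : R) (n m : nat) (G : sgraph 'I_n),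
       0 <= sigma -> 0 <= eps -> sigma + eps <= 1 ->
       (1 < m <= n)%N -> admissible gamma n m ->
       (no_dense_subset G m sigma ->
          Density G gamma m
            <= 'C(n, m)%:R * expR (gamma * m%:R * sigma + K / m%:R))
       /\
       (many_dense_subsets G gamma m sigma eps ->
          2 * 'C(n, m)%:R * expR (gamma * m%:R * sigma - K / m%:R)
            <= Density G gamma m))
    /\
    (exists P : cmd,
       forall (sigma eps : R) (n m : nat) (G : sgraph 'I_n),
         0 <= sigma -> 0 <= eps -> sigma + eps <= 1 ->
         (1 < m <= n)%N -> admissible gamma n m ->
         no_dense_subset G m sigma \/ many_dense_subsets G gamma m sigma eps ->
         exists (t : nat) (s : memory R),
           [/\ exec P (input m G sigma eps) t s,
               t%:R <= n%:R `^ (L * ln m%:R),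
               no_dense_subset G m sigma -> output s = 1%N
             & many_dense_subsets G gamma m sigma eps -> output s = 0%N]).
Proof.
(* The number of steps is at most n (27 n + 55) + 200 <= 2^7 n^2 <= n^9, and
   18 ln m >= 9 because m >= 2. *)
exists 1, 18 => gamma; split=> [sigma eps n m G s0 e0 se1 mn adm|].
  have := @Density_upper R _ G gamma m sigma.
  have := @Density_lower R _ G gamma m sigma eps.
  rewrite card_ord => low up; split=> h; last exact: low.
  by apply: up => //; case/andP: mn.
exists program => sigma eps n m G s0 e0 se1 mn adm _.
case/andP: (mn) => m1 mn'; have n0 : (0 < n)%N by lia.
have [t [s [E tT out]]] := runs_program G sigma eps mn'.
rewrite threshold_valueE// -bin2R in out.
exists t, s; split=> //.
- have n2 : 2 <= n%:R :> R by rewrite ler_nat; lia.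
  have ln2 : 1 / 2 <= ln (m%:R : R).
    have e2 := @expR_13_20_lt2 R.
    rewrite -ler_expR lnK ?posrE ?ltr0n; last by lia.
    apply: (@le_trans _ _ (expR (13 / 20))); first by rewrite ler_expR; lra.
    by apply: (le_trans (ltW e2)); rewrite ler_nat.
  apply: (@le_trans _ _ (n%:R `^ 9%:R)); last by rewrite ler_powR; lra.
  rewrite powR_mulrn//.
  apply: (@le_trans _ _ ((n * (27 * n + 55) + 200)%N%:R)); first by rewrite ler_nat.
  rewrite !natrD !natrM natrD natrM.
  have n7 : 128 <= n%:R ^+ 7 :> R.
    by apply: (@le_trans _ _ (2 ^+ 7)); [lra|rewrite lerXn2r ?nnegrE].
  apply: (@le_trans _ _ (128 * n%:R ^+ 2)); first by nra.
  have -> : n%:R ^+ 9 = n%:R ^+ 7 * n%:R ^+ 2 :> R by rewrite -exprD.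
  by rewrite ler_wpM2r// sqr_ge0.
- move=> nd; rewrite out ltNge; have := @threshold_of_no_dense R _ G m sigma.
  by rewrite card_ord => ->.
- move=> md; rewrite out; have := @threshold_of_many_dense R _ G gamma m sigma eps.
  by rewrite card_ord => ->.
Qed.
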